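(* Let $Q=\{\mathrm{id},(1,2),(0,3),(0,3)(1,2)\}\simeq\mathbb Z_2\times\mathbb Z_2$, a subgroup of the group $\mathfrak S_4$ of permutations of $\{0,1,2,3\}$. Then the action of $(1,2)\in Q$ on the Radon hypergeometric function of type $(1,1,1,1)$ induces the identity $${}_2\mathcal F_1(a,b,c;x)=\bigl(\det(1_r-x)\bigr)^{-b}\,{}_2\mathcal F_1\bigl(c-a,b,c;x(x-1_r)^{-1}\bigr),$$ where ${}_2\mathcal F_1$ is the Hermitian matrix integral analogue of the Gauss hypergeometric function.
   Context: Let $r\ge1$ be an integer, $1_r$ the identity matrix of size $r$, and $\mathscr H(r)$ the real vector space of complex Hermitian $r\times r$ matrices. For $U\in\mathscr H(r)$, write $|U|=\det U$; $U>0$ means that $U$ is positive definite; $0<U<1_r$ means $U>0$ and $1_r-U>0$; $\operatorname{etr}(U)=\exp(\operatorname{Tr}U)$; and $dU=\bigwedge_i dU_{i,i}\bigwedge_{i<j}d(\operatorname{Re}U_{i,j})\wedge d(\operatorname{Im}U_{i,j})$ is the Euclidean volume form. Put $$\Gamma_r(a)=\int_{U>0}\operatorname{etr}(-U)|U|^{a-r}dU,$$ $${}_2\mathcal F_1(a,b,c;X)=\frac{\Gamma_r(c)}{\Gamma_r(a)\Gamma_r(c-a)}\int_{0<U<1_r}|U|^{a-r}|1_r-U|^{c-a-r}|1_r-UX|^{-b}\,dU,\qquad X\in\mathscr H(r).$$ The Radon hypergeometric function of type $(1,1,1,1)$. Let $Z$ be the set of $z=(z_0,z_1,z_2,z_3)\in\mathrm{Mat}(2r,4r)$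 with $z_j\in\mathrm{Mat}(2r,r)$ and $\det(z_i,z_j)\ne0$ for $i\ne j$. For $\alpha=(\alpha_0,\alpha_1,\alpha_2,\alpha_3)\in\mathbb C^4$ with $\alpha_j\notin\mathbb Z$ and $\alpha_0+\alpha_1+\alpha_2+\alpha_3=-2r$, it is $$F(z,\alpha;C)=\int_{C(z)}\prod_{0\le j\le3}(\det tz_j)^{\alpha_j}\,\tau(t),$$ where $t=(t',t'')$ with $t',t''\in\mathrm{Mat}(r)$ is the homogeneous coordinate of the Grassmannian $\mathrm{Gr}(r,2r)$ of $r$-dimensional subspaces of $\mathbb C^{2r}$, $\tau(t)=(\det t')^{2r}du$ with $u=(t')^{-1}t''$ and $du=\bigwedge_{i,j}du_{i,j}$, and $C(z)$ is an $r^2$-cycle of the homology group, with coefficients in the local system given by the monodromy of the integrand and with the family of supports determined by the integrand, of the complement in $\mathrm{Gr}(r,2r)$ of the hypersurfaces $\det(tz_j)=0$. Action of $\mathfrak S_4$. A transposition $\sigma\in\mathfrak S_4$ corresponds to the block permutation matrix $P_\sigma=(\delta_{\sigma(i),j}1_r)_{0\le i,j\le3}\in\mathrm{GL}(4r)$ and acts by $z\mapsto zP_\sigma$ and $\alpha\mapsto\sigma(\alpha)$, the corresponding permutation of the entries of $\alpha$; the Radon hypergeometric function satisfies $F(zP_\sigma,\sigma(\alpha);C)=F(z,\alpha;C)$. For $\sigma=(1,2)$, $\sigma(\alpha)=(\alpha_0,\alpha_2,\alpha_1,\alpha_3)$. Relation between the two functions. With $$\mathbf x=\begin{pmatrix}1_r&0&1_r&1_r\\0&1_r&-1_r&-x\end{pmatrix},\qquad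 C=\{u\in\mathscr H(r)\mid u>0,\ 1_r-u>0\},$$ one has $${}_2\mathcal F_1(a,b,c;x)=A(\alpha)F(\mathbf x,\alpha;C)=A(\alpha)\int_C(\det u)^{\alpha_1}(\det(1_r-u))^{\alpha_2}(\det(1_r-ux))^{\alpha_3}du,$$ where $(a,b,c)=(\alpha_1+r,-\alpha_3,\alpha_1+\alpha_2+2r)$ and $A(\alpha)=\left(\frac{\sqrt{-1}}{2}\right)^{r(r-1)/2}\frac{\Gamma_r(\alpha_1+\alpha_2+2r)}{\Gamma_r(\alpha_1+r)\Gamma_r(\alpha_2+r)}$. *)

(* Defs.v *)
From HB Require Import structures.
From mathcomp Require Import all_boot all_order all_algebra all_fingroup.
From mathcomp Require Import sesquilinear spectral complex.
From mathcomp Require Import all_classical all_reals all_analysis.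

Set Implicit Arguments.
Unset Strict Implicit.
Unset Printing Implicit Defensive.

Import Order.TTheory GRing.Theory Num.Theory.
Import numFieldNormedType.Exports.
Local Open Scope classical_set_scope.
Local Open Scope ring_scope.

Section ComplexPower.
Variable R : realType.
Implicit Types z s : R[i].

Definition cexp z : R[i] :=
  Complex (expR (complex.Re z) * cos (complex.Im z))
          (expR (complex.Re z) * sin (complex.Im z)).

Definition cabs z : R := Num.sqrt (complex.Re z ^+ 2 + complex.Im z ^+ 2).

(* Principal argument, with values in ]-pi, pi]. *)
Definition carg z : R :=
  let theta := acos (complex.Re z / cabs z) in
  if 0 <= complex.Im z then theta else - theta.

Definition clog z : R[i] := Complex (ln (cabs z)) (carg z).

(* Principal branch of z ^ s; the value at z = 0 is a dummy. *)
Definition cpow z s : R[i] := cexp (s * clog z).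

End ComplexPower.

Section LebesgueTuple.
Variable R : realType.
Local Open Scope ereal_scope.

Definition cons_pair n (p : R * n.-tuple R) : n.+1.-tuple R :=
  [tuple of p.1 :: p.2].

Lemma measurable_cons_pair n :
  measurable_fun [set: R * n.-tuple R] (@cons_pair n).
Proof. exact: (measurable_cons measurable_fst measurable_snd). Qed.

Section Step.
Variables (n : nat) (nu : {sigma_finite_measure set n.-tuple R -> \bar R}).

(* The product of Lebesgue measure on the first coordinate with nu on the
   remaining ones. *)
Definition lebesgue_cons : set (n.+1.-tuple R) -> \bar R :=
  pushforward (@lebesgue_measure R \x nu) (@cons_pair n).

HB.instance Definition _ := Measure.copy lebesgue_cons
  (measure_function_pushforward__canonical__measure_function_Measure
     (@lebesgue_measure R \x nu) (@measurable_cons_pair n)).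

(* Proved directly: on products, canonical-structure inference finds the
   library's subprobability instance instead of its sigma-finite one. *)
Let lebesgue_cons_sigma_finite : sigma_finite [set: _] lebesgue_cons.
Proof.
have /sigma_finiteP[F [TF ndF Foo]] := sigma_finiteT (@lebesgue_measure R).
have /sigma_finiteP[G [TG ndG Goo]] := sigma_finiteT nu.
pose u (t : n.+1.-tuple R) : measurableTypeR R * n.-tuple R :=
  (tnth t ord0, [tuple of behead t]).
have mu_ : measurable_fun [set: _] u.
  apply: measurable_fun_pair; first exact: measurable_tnth.
  exact: measurable_behead.
have uK : cancel (@cons_pair n) u.
  by case=> x t; rewrite /u tnth0; congr pair; exact/val_inj.
exists (fun k => u @^-1` (F k `*` G k)).
  apply/seteqP; split=> [t _|//].
  have [i _ Fi] : (\bigcup_i F i) (u t).1 by rewrite -TF.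
  have [j _ Gj] : (\bigcup_i G i) (u t).2 by rewrite -TG.
  exists (maxn i j) => //; split.
  - by move: Fi; exact/subsetPset/ndF/leq_maxl.
  - by move: Gj; exact/subsetPset/ndG/leq_maxr.
move=> k; have [mF Fk] := Foo k; have [mG Gk] := Goo k; split.
  by rewrite -[X in measurable X]setTI; apply: mu_ => //; exact: measurableX.
rewrite /lebesgue_cons /pushforward -comp_preimage.
rewrite (_ : u \o _ = id); last by apply/funext => p; exact: uK.
by rewrite preimage_id product_measure1E// lte_mul_pinfty// ge0_fin_numE.
Qed.

HB.instance Definition _ := Measure_isSigmaFinite.Build _ _ _ lebesgue_cons
  lebesgue_cons_sigma_finite.

End Step.

(* Lebesgue measure on R^n. *)
Fixpoint tuple_lebesgue n : {sigma_finite_measure set n.-tuple R -> \bar R} :=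
  match n with
  | 0 => @dirac _ (0.-tuple R) [tuple] R
  | m.+1 => lebesgue_cons (tuple_lebesgue m)
  end.

End LebesgueTuple.

Section HermitianIntegral.
Variables (R : realType) (r : nat).
Local Notation C := R[i].
Implicit Types (U X : 'M[C]_r) (D : set 'M[C]_r) (a b c : C).

Definition posdef U : Prop :=
  U \is hermsymmx /\
  forall v : 'cV[C]_r, v != 0 -> 0 < (map_mx Num.conj v^T *m U *m v) 0 0.

(* Real coordinates on the space of Hermitian matrices: the entries (i, i),
   (i, j) and (j, i) with i < j of an array of r * r reals are U_ii, Re U_ij
   and Im U_ij. *)
Definition herm_of (t : (r * r).-tuple R) : 'M[C]_r :=
  \matrix_(i, j)
    let y k l := tnth t (mxvec_index k l) in
    if i == j then Complex (y i i) 0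
    else if (i < j)%N then Complex (y i j) (y j i)
    else Complex (y j i) (- y i j).

(* The integral of f over D with respect to dU, for D a set of Hermitian
   matrices. *)
Definition herm_integral D (f : 'M[C]_r -> C) : C :=
  Complex
    (\int[tuple_lebesgue R (r * r)]_(t in herm_of @^-1` D)
       complex.Re (f (herm_of t)))
    (\int[tuple_lebesgue R (r * r)]_(t in herm_of @^-1` D)
       complex.Im (f (herm_of t))).

Definition pos_cone : set 'M[C]_r := [set U | posdef U].

Definition unit_box : set 'M[C]_r := [set U | posdef U /\ posdef (1%:M - U)].

Definition etr U : C := cexp (\tr U).

Definition Gamma_herm a : C :=
  herm_integral pos_cone (fun U => etr (- U) * cpow (\det U) (a - r%:R)).

Definition hypergeo a b c X : C :=
  Gamma_herm c / (Gamma_herm a * Gamma_herm (c - a)) *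
  herm_integral unit_box (fun U =>
    cpow (\det U) (a - r%:R) * cpow (\det (1%:M - U)) (c - a - r%:R) *
    cpow (\det (1%:M - U *m X)) (- b)).

End HermitianIntegral.

Arguments pos_cone R r : clear implicits.
Arguments unit_box R r : clear implicits.

Section Radon.
Variables (R : realType) (r : nat).
Local Notation C := R[i].
(* z = (z_0, z_1, z_2, z_3), with blocks z_j of size 2r * r. *)
Local Notation config := 'M[C]_(r + r, \sum_(j < 4) r).
Implicit Types (z : config) (alpha : 'I_4 -> C) (s : 'S_4).

Definition zblock z (j : 'I_4) : 'M[C]_(r + r, r) := submxrow z j.

Definition config_generic z : Prop :=
  forall i j : 'I_4, i != j -> \det (row_mx (zblock z i) (zblock z j)) != 0.

Definition exponents_admissible alpha : Prop :=
  (forall (j : 'I_4) (m : int), alpha j != m%:~R) /\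
  \sum_j alpha j = - (r + r)%:R.

(* The factors of the integrand other than du: the last one comes from
   tau(t) = (det t')^(2r) du. *)
Definition radon_integrand z alpha (t : 'M[C]_(r, r + r)) : C :=
  (\prod_j cpow (\det (t *m zblock z j)) (alpha j)) *
  \det (lsubmx t) ^+ (r + r).

(* The Radon integral over a chain D lying in the Hermitian slice of the affine
   chart t = (1_r, u) of the Grassmannian.  On that slice
   du_ij /\ du_ji = - 2 i d(Re u_ij) /\ d(Im u_ij) for i < j, hence
   du = (- 2 i)^(r (r - 1) / 2) dU. *)
Definition radon z alpha (D : set 'M[C]_r) : C :=
  (- 2 * Complex 0 1) ^+ (r * r.-1)./2 *
  herm_integral D (fun u => radon_integrand z alpha (row_mx 1%:M u)).

Definition perm_block s : 'M[C]_(\sum_(i < 4) r, \sum_(j < 4) r) :=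
  \mxblock_(i < 4, j < 4) (if s i == j then 1%:M else 0 : 'M[C]_r).

(* The permutation of the exponents matching z |-> z *m perm_block s, whose
   j-th block is the (s^-1 j)-th block of z. *)
Definition perm_exponents s alpha : 'I_4 -> C := fun j => alpha (s^-1%g j).

Definition xconfig (x : 'M[C]_r) : config :=
  \mxrow_(j < 4)
    (nth 0 [:: col_mx 1%:M 0; col_mx 0 1%:M;
               col_mx 1%:M (- 1%:M); col_mx 1%:M (- x)] j : 'M[C]_(r + r, r)).

Definition radon_const alpha : C :=
  let a1 := alpha (inord 1) in let a2 := alpha (inord 2) in
  (Complex 0 1 / 2) ^+ (r * r.-1)./2 *
  (Gamma_herm r (a1 + a2 + (r + r)%:R) /
   (Gamma_herm r (a1 + r%:R) * Gamma_herm r (a2 + r%:R))).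

End Radon.

Definition s12 : 'S_4 := tperm (inord 1) (inord 2).
Definition s03 : 'S_4 := tperm (inord 0) (inord 3).

Definition Q : {set 'S_4} := [set 1%g; s12; s03; (s03 * s12)%g].

(* Main.v *)
Require Import Defs.
From mathcomp Require Import all_boot all_order all_algebra all_fingroup.
From mathcomp Require Import abelian.
From mathcomp Require Import sesquilinear spectral complex.
From mathcomp Require Import all_classical all_reals all_analysis.
From mathcomp Require Import measurable_realfun ring lra.

(* The substitution U |-> 1 - U exchanges det U and det (1 - U), and
   det (1 - (1 - U) x) = det (1 - x) * det (1 - U y) with y = x (x - 1)^-1;
   all these determinants are positive on the unit box, so principal powers are
   multiplicative there.  In the coordinates of dU the substitution reflects
   each coordinate, hence preserves Lebesgue measure.

   Since (det (1 - x)) ^ (- b) is a complex constant, moving it out of the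
   integral requires absolute convergence, that is, finiteness of the integral
   of (det U)^p (det (1 - U))^q over the unit box for p, q > -1.  Write U in
   blocks (u, v; v^*, U').  By Schur complements, integrating over u gives a
   beta integral equal, up to a constant, to
     (det U')^p (det (1 - U'))^q (1 - v H v^* )^(p + q + 1)
   with H = U'^-1 + (1 - U')^-1.  An LDL decomposition of H turns v H v^* into a
   weighted sum of |v_i + (linear form in the v_j, j > i)|^2, so that v can be
   integrated one real coordinate at a time; the total is a constant times
   1 / det H = det U' det (1 - U').  The result
   (det U')^(p + 1) (det (1 - U'))^(q + 1) is bounded by 1 on the unit box. *)

Set Implicit Arguments.
Unset Strict Implicit.
Unset Printing Implicit Defensive.

Import Order.TTheory GRing.Theory Num.Theory.
Import numFieldNormedType.Exports.
Local Open Scope ring_scope.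

(** * Positive definite Hermitian matrices *)

Section Posdef.
Local Open Scope classical_set_scope.
Local Open Scope sesquilinear_scope.
Variable R : realType.
Local Notation C := R[i].

(** Only finiteness is needed, so every beta integral is replaced by an upper bound whose constant
    depends on the exponents alone; this uniformity is what allows the corner U' to vary. There is
    no induction on r: after the first row has been integrated out the bound is a constant, and the
    entries of U' stay in a cube of finite volume.

    The matrix x may be indefinite and U x is not Hermitian. Still, a left eigenvector v of 1 - U x
    with eigenvalue mu satisfies (1 - mu) v U v^* = w x w^* with w = v U, which makes mu real and
    bounded below uniformly in U. Hence the third factor has a real base lying between two positive
    constants, and it affects neither the branch nor convergence. Since 1 - y = (1 - x)^-1 is again
    positive definite, the same bounds serve both sides of the identity.

    The assumptions on a and c - a say exactly that the exponents a - r and c - a - r have real part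
    > -1.

    Measurability of the box is a separate obstacle, because positive definiteness quantifies over
    uncountably many vectors; it is reduced to finitely many sign conditions on the characteristic
    polynomial. *)

Lemma trmxC_mul m n p (A : 'M[C]_(m, n)) (B : 'M[C]_(n, p)) :
  (A *m B)^t* = B^t* *m A^t*.
Proof. by rewrite trmx_mul map_mxM. Qed.

Lemma trmxCK m n (A : 'M[C]_(m, n)) : (A^t*)^t* = A.
Proof. by apply/matrixP => i j; rewrite !mxE conjCK. Qed.

Lemma trmxCD m n (A B : 'M[C]_(m, n)) : (A + B)^t* = A^t* + B^t*.
Proof. by rewrite linearD map_mxD. Qed.

Lemma trmxCN m n (A : 'M[C]_(m, n)) : (- A)^t* = - A^t*.
Proof. by rewrite linearN map_mxN. Qed.

Lemma trmxCZ m n k (A : 'M[C]_(m, n)) : (k *: A)^t* = k^* *: A^t*.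
Proof. by apply/matrixP => i j; rewrite !mxE rmorphM. Qed.

Lemma trmxC1 n : (1%:M : 'M[C]_n)^t* = 1%:M.
Proof. by rewrite trmx1 map_mx1. Qed.

Lemma hermsymmxE n (A : 'M[C]_n) : (A \is hermsymmx) = (A^t* == A).
Proof. by rewrite is_hermitianmxE expr0 scale1r eq_sym. Qed.

(** Row vectors fit both [eigenvalue], which speaks of left eigenvectors, and the first row v of a
    block matrix, the later argument of the form. *)
Definition qform n (A : 'M[C]_n) (v : 'rV[C]_n) : C := (v *m A *m v^t*) 0 0.

Lemma qformD n (A B : 'M[C]_n) v : qform (A + B) v = qform A v + qform B v.
Proof. by rewrite /qform mulmxDr mulmxDl mxE. Qed.

Lemma qformN n (A : 'M[C]_n) v : qform (- A) v = - qform A v.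
Proof. by rewrite /qform mulmxN mulNmx mxE. Qed.

Lemma qform_congr m n (B : 'M[C]_(m, n)) (A : 'M[C]_n) v :
  qform (B *m A *m B^t*) v = qform A (v *m B).
Proof. by rewrite /qform trmxC_mul !mulmxA. Qed.

Lemma qform1E n (v : 'rV[C]_n) : qform 1%:M v = \sum_i `|v 0 i| ^+ 2.
Proof.
rewrite /qform mulmx1 mxE; apply: eq_bigr => i _.
by rewrite !mxE normCK.
Qed.

Lemma qform1_ge0 n (v : 'rV[C]_n) : 0 <= qform 1%:M v.
Proof. by rewrite qform1E sumr_ge0// => i _; rewrite exprn_ge0. Qed.

Lemma qform1_gt0 n (v : 'rV[C]_n) : v != 0 -> 0 < qform 1%:M v.
Proof.
move=> v0; rewrite lt_def qform1_ge0 andbT; apply: contra v0 => /eqP.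
rewrite qform1E => /eqP; rewrite psumr_eq0; last by move=> i _; rewrite exprn_ge0.
move=> /allP v0; apply/eqP/rowP => i; rewrite mxE; apply/eqP.
by have := v0 i (mem_index_enum i); rewrite sqrf_eq0 normr_eq0.
Qed.

Lemma qform_diag n (d : 'rV[C]_n) v :
  qform (diag_mx d) v = \sum_i d 0 i * `|v 0 i| ^+ 2.
Proof.
rewrite /qform mul_mx_diag mxE; apply: eq_bigr => i _.
by rewrite !mxE normCK mulrAC mulrA mulrC mulrA.
Qed.

Lemma posdefP n (A : 'M[C]_n) :
  posdef A <-> A^t* = A /\ forall v, v != 0 -> 0 < qform A v.
Proof.
rewrite /posdef hermsymmxE; split=> -[hA A0].
  split; first exact/eqP.
  move=> v v0; have := A0 (v^t*); rewrite /qform.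
  rewrite (_ : map_mx _ (v^t*)^T = v); last exact: trmxCK.
  apply; apply: contra v0 => /eqP /(congr1 (fun z => z^t*)).
  by rewrite trmxCK => ->; rewrite trmx0 map_mx0.
split; first exact/eqP.
move=> v v0; have := A0 (v^t*); rewrite /qform trmxCK.
apply; apply: contra v0 => /eqP /(congr1 (fun z => z^t*)).
by rewrite trmxCK => ->; rewrite trmx0 map_mx0.
Qed.

Lemma posdef_trmxC n (A : 'M[C]_n) : posdef A -> A^t* = A.
Proof. by case/posdefP. Qed.

Lemma posdef_qform_gt0 n (A : 'M[C]_n) v : posdef A -> v != 0 -> 0 < qform A v.
Proof. by move=> /posdefP[_]; apply. Qed.

Lemma posdef_qform_ge0 n (A : 'M[C]_n) v : posdef A -> 0 <= qform A v.
Proof.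
move=> pA; have [->|/(posdef_qform_gt0 pA)/ltW//] := eqVneq v 0.
by rewrite /qform !mul0mx mxE.
Qed.

Lemma posdefD n (A B : 'M[C]_n) : posdef A -> posdef B -> posdef (A + B).
Proof.
move=> /posdefP[hA pA] /posdefP[hB pB]; apply/posdefP.
by rewrite trmxCD hA hB; split=> // v v0; rewrite qformD addr_gt0 ?pA ?pB.
Qed.

Lemma posdef_congr m n (B : 'M[C]_(m, n)) (A : 'M[C]_n) :
  (forall v : 'rV_m, v *m B = 0 -> v = 0) ->
  posdef A -> posdef (B *m A *m B^t*).
Proof.
move=> B0 /posdefP[hA pA]; apply/posdefP; split.
  by rewrite !trmxC_mul trmxCK hA mulmxA.
move=> v v0; rewrite qform_congr pA//.
by apply: contra v0 => /eqP/B0 ->.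
Qed.

Lemma posdef_drsubmx m n (A : 'M[C]_(m + n)) : posdef A -> posdef (drsubmx A).
Proof.
move=> pA; have -> : drsubmx A = row_mx 0 1%:M *m A *m (row_mx 0 1%:M)^t*.
  rewrite -{2}(submxK A) mul_row_block !mul0mx !mul1mx !add0r.
  rewrite tr_row_mx map_col_mx trmx0 map_mx0 trmx1 map_mx1 mul_row_col.
  by rewrite mulmx0 mulmx1 add0r.
apply: posdef_congr => // v; rewrite mul_mx_row mulmx0 mulmx1 => /eqP.
by rewrite -(row_mx0 C 1 m n) => /eqP/eq_row_mx[].
Qed.

Lemma posdef_eigenvalue_gt0 n (A : 'M[C]_n) mu :
  posdef A -> eigenvalue A mu -> 0 < mu.
Proof.
move=> pA /eigenvalueP[v vA v0].
have := posdef_qform_gt0 pA v0; rewrite /qform vA -scalemxAl mxE.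
rewrite -[v in v *m _]mulmx1 -/(qform 1%:M v) pmulr_lgt0//.
exact: qform1_gt0.
Qed.

(** The characteristic polynomial splits over R[i]. No symmetry of A is required, so determinant
    bounds can be read off from eigenvalue bounds even for the non-Hermitian 1 - U x. *)
Lemma det_seq_eigenvalue n (A : 'M[C]_n) :
  exists s, [/\ size s = n, \det A = \prod_(z <- s) z,
    char_poly A = \prod_(z <- s) ('X - z%:P) &
    forall z, (z \in s) = eigenvalue A z].
Proof.
have [s] := closed_field_poly_normal (char_poly A).
rewrite (monicP (char_poly_monic A)) scale1r => sE; exists s.
have ss : size s = n.
  by have := size_char_poly A; rewrite sE size_prod_XsubC => -[].
split=> //; last first.
  by move=> z; rewrite eigenvalue_root_char sE root_prod_XsubC.
have := char_poly_det A; rewrite sE -horner_coef0 horner_prod.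
under eq_bigr do rewrite hornerXsubC sub0r.
rewrite -(big_map (fun z => - z) predT id).
have -> : \prod_(i <- [seq - z | z <- s]) i = (-1) ^+ size s * \prod_(i <- s) i.
  elim: (s) => [|z t IH]; first by rewrite !big_nil expr0 mulr1.
  by rewrite /= !big_cons IH exprS !mulrA; congr (_ * _); rewrite mulN1r !mulNr mulrC.
by rewrite ss => /(congr1 ( *%R ((-1) ^+ n))); rewrite !mulrA -expr2 sqrr_sign !mul1r.
Qed.

Lemma det_ge n (A : 'M[C]_n) e : 0 <= e ->
  (forall mu, eigenvalue A mu -> e <= mu) -> e ^+ n <= \det A.
Proof.
move=> e0 Ae; have [s [ss -> _ sE]] := det_seq_eigenvalue A.
have {sE}: forall z, z \in s -> e <= z by move=> z; rewrite sE => /Ae.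
rewrite -ss {ss}.
elim: s => [|z s IH] h; first by rewrite big_nil expr0.
rewrite big_cons exprS ler_pM ?exprn_ge0 ?h ?mem_head//.
by apply: IH => y ys; rewrite h// inE ys orbT.
Qed.

Lemma det_le1 n (A : 'M[C]_n) :
  (forall mu, eigenvalue A mu -> 0 <= mu <= 1) -> \det A <= 1.
Proof.
move=> Ae; have [s [_ -> _ sE]] := det_seq_eigenvalue A.
have {sE}: forall z, z \in s -> 0 <= z <= 1 by move=> z; rewrite sE => /Ae.
move=> h; suff /andP[] : 0 <= \prod_(z <- s) z <= 1 by [].
elim: s h => [|z s IH] h; first by rewrite big_nil ler01 lexx.
have /andP[z0 z1] := h z (mem_head _ _).
have /andP[p0 p1] : 0 <= \prod_(z <- s) z <= 1.
  by apply: IH => y ys; rewrite h// inE ys orbT.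
by rewrite big_cons mulr_ge0//= mulr_ile1.
Qed.

Lemma posdef_det_gt0 n (A : 'M[C]_n) : posdef A -> 0 < \det A.
Proof.
move=> pA; have [s [_ -> _ sE]] := det_seq_eigenvalue A.
rewrite big_seq prodr_gt0// => z; rewrite sE; exact: posdef_eigenvalue_gt0.
Qed.

Lemma posdef_unit n (A : 'M[C]_n) : posdef A -> A \in unitmx.
Proof. by move=> pA; rewrite unitmxE unitfE gt_eqF// posdef_det_gt0. Qed.

Lemma posdef_inv n (A : 'M[C]_n) : posdef A -> posdef (invmx A).
Proof.
move=> pA; have uA := posdef_unit pA.
have hA : (invmx A)^t* = invmx A by rewrite trmx_inv map_invmx posdef_trmxC.
have -> : invmx A = invmx A *m A *m (invmx A)^t*.
  by rewrite hA mulVmx// mul1mx.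
apply: posdef_congr => // v /(congr1 (fun M => M *m A)).
by rewrite mulmxKV// mul0mx.
Qed.

Lemma hermitian_spectral n (A : 'M[C]_n) : A^t* = A ->
  exists P (d : 'rV[C]_n), [/\ P *m P^t* = 1%:M, P^t* *m P = 1%:M,
    A = P^t* *m diag_mx d *m P, forall i, d 0 i \is Num.real &
    forall i, eigenvalue A (d 0 i)].
Proof.
move=> /eqP; rewrite -hermsymmxE => hA.
have /hermitian_normalmx/orthomx_spectralP AE := hA.
have /mxOverP dR := hermitian_spectral_diag_real hA.
set P := spectralmx A in AE; set d := spectral_diag A in AE dR.
have uP : P \is unitarymx := spectral_unitarymx A.
rewrite invmx_unitary// in AE.
have PP : P *m P^t* = 1%:M by apply/unitarymxP.
have PP' : P^t* *m P = 1%:M by exact: mulmx1C.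
exists P, d; split=> // i; apply/eigenvalueP; exists ((delta_mx 0 i : 'rV_n) *m P).
  rewrite {1}AE !mulmxA -(mulmxA _ P) PP mulmx1.
  have -> : (delta_mx 0 i : 'rV_n) *m diag_mx d = d 0 i *: delta_mx 0 i.
    by rewrite -rowE row_diag_mx.
  by rewrite -scalemxAl.
apply/eqP => /(congr1 (fun M => M *m P^t*)).
rewrite -mulmxA PP mulmx1 mul0mx => /matrixP/(_ 0 i).
by rewrite !mxE !eqxx => /eqP; rewrite oner_eq0.
Qed.

Lemma posdef_coercive n (A : 'M[C]_n) : posdef A ->
  exists2 e, 0 < e <= 1 & forall v, e * qform 1%:M v <= qform A v.
Proof.
move=> pA; have [P [d [PP PP' AE _ dA]]] := hermitian_spectral (posdef_trmxC pA).
have d0 i : 0 < d 0 i := posdef_eigenvalue_gt0 pA (dA i).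
(* A closed form replacing the least eigenvalue: it is below every d_i, and the added 1 gives e <=
   1, also in size 0. *)
pose e := (1 + \sum_i (d 0 i)^-1)^-1.
have s0 : 0 <= \sum_i (d 0 i)^-1.
  by apply: sumr_ge0 => i _; rewrite invr_ge0 ltW.
have e0 : 0 < e by rewrite invr_gt0 ltr_wpDr.
have ed i : e <= d 0 i.
  rewrite -[d 0 i]invrK lef_pV2 ?posrE ?invr_gt0 ?ltr_wpDr//.
  rewrite (bigD1 i)//= addrCA lerDl addr_ge0//.
  by apply: sumr_ge0 => j _; rewrite invr_ge0 ltW.
exists e; first by rewrite e0 invf_le1 ?ltr_wpDr// lerDl.
move=> v; have -> : qform 1%:M v = qform 1%:M (v *m P^t*).
  by rewrite -qform_congr mulmx1 trmxCK PP'.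
have {}AE : A = P^t* *m diag_mx d *m (P^t*)^t* by rewrite trmxCK.
rewrite AE qform_congr qform_diag qform1E mulr_sumr.
by apply: ler_sum => i _; rewrite ler_wpM2r ?exprn_ge0.
Qed.

Section Box.
Variables (n : nat) (U : 'M[C]_n).
Hypothesis boxU : unit_box R n U.

Let pU : posdef U. Proof. by case: boxU. Qed.
Let pU1 : posdef (1%:M - U). Proof. by case: boxU. Qed.

Lemma unit_box_eigenvalue mu : eigenvalue U mu -> 0 < mu < 1.
Proof.
move=> muU; rewrite (posdef_eigenvalue_gt0 pU muU)/=.
rewrite -subr_gt0; apply: (posdef_eigenvalue_gt0 pU1).
move: muU => /eigenvalueP[v vU v0]; apply/eigenvalueP; exists v => //.
by rewrite mulmxBr mulmx1 vU scalerBl scale1r.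
Qed.

Lemma unit_box_det_le1 : \det U <= 1.
Proof. by apply: det_le1 => mu /unit_box_eigenvalue/andP[/ltW-> /ltW->]. Qed.

(** U - U^2 = U (1 - U) U + (1 - U) U (1 - U) is a sum of two congruences of positive matrices, so
    no square root or diagonalization is involved. *)
Lemma unit_box_sqr v : qform (U *m U) v <= qform U v.
Proof.
rewrite -subr_ge0 -qformN -qformD.
have -> : U - U *m U = U *m (1%:M - U) *m U^t* +
    (1%:M - U) *m U *m (1%:M - U)^t*.
  rewrite (posdef_trmxC pU) (posdef_trmxC pU1).
  rewrite !(mulmxBr, mulmxBl, mulmx1, mul1mx).
  by rewrite [RHS]addrC subrK.
by rewrite qformD !qform_congr addr_ge0 ?posdef_qform_ge0.
Qed.

(** The squared norm of row i is (U^2)_ii, which is at most U_ii, and U_ii < 1. *)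
Lemma unit_box_entry i j : `|U i j| <= 1.
Proof.
rewrite -(@ler_pXn2r _ 2)// ?nnegrE ?ler01// expr1n.
have qE (A : 'M[C]_n) : qform A (delta_mx 0 i) = A i i.
  rewrite /qform -rowE (_ : (delta_mx 0 i)^t* = delta_mx i 0).
    by rewrite -colE !mxE.
  by apply/matrixP=> a b; rewrite !mxE conjC_nat andbC.
have := unit_box_sqr (delta_mx 0 i); rewrite !qE.
have : 0 < qform (1%:M - U) (delta_mx 0 i).
  apply: (posdef_qform_gt0 pU1); apply/eqP => /matrixP/(_ 0 i).
  by rewrite !mxE !eqxx => /eqP; rewrite oner_eq0.
rewrite qE !mxE eqxx subr_gt0 => /ltW Uii Uij.
apply: le_trans (le_trans Uij Uii).
rewrite (bigD1 j)//=.
have UE k : U i k * U k i = `|U i k| ^+ 2.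
  by rewrite normCK; congr (_ * _); rewrite -{1}(posdef_trmxC pU) !mxE.
rewrite UE lerDl; apply: sumr_ge0 => k _.
by rewrite UE exprn_ge0.
Qed.

(** If v (1 - U x) = mu v, then v U x = (1 - mu) v. Multiplying by U v^* on the right gives (1 - mu)
    q_U(v) = q_x(v U) <= (1 - e) q_1(v U) = (1 - e) q_{U^2}(v) <= (1 - e) q_U(v), and q_U(v) > 0 can
    be cancelled. *)
Lemma unit_box_det_ge (x : 'M[C]_n) e : x^t* = x -> 0 < e <= 1 ->
  (forall v, e * qform 1%:M v <= qform (1%:M - x) v) ->
  e ^+ n <= \det (1%:M - U *m x).
Proof.
move=> hx /andP[e0 e1] ex; apply: det_ge (ltW e0) _ => mu /eigenvalueP[v].
rewrite mulmxBr mulmx1 => /eqP; rewrite subr_eq addrC -subr_eq => /eqP vE v0.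
have q0 : 0 < qform U v by exact: posdef_qform_gt0.
have : (1 - mu) * qform U v = qform x (v *m U).
  rewrite /qform trmxC_mul (posdef_trmxC pU) -[v *m U *m x]mulmxA -vE.
  have -> : v - mu *: v = (1 - mu) *: v by rewrite scalerBl scale1r.
  by rewrite -scalemxAl [RHS]mxE !mulmxA.
have : qform x (v *m U) <= (1 - e) * qform U v.
  apply: (@le_trans _ _ ((1 - e) * qform 1%:M (v *m U))).
    rewrite mulrBl mul1r lerBrDr -lerBrDl (le_trans (ex _))//.
    by rewrite qformD qformN.
  rewrite ler_wpM2l ?subr_ge0// -qform_congr mulmx1 (posdef_trmxC pU).
  exact: unit_box_sqr.
by move=> /[swap] <-; rewrite ler_pM2r// lerD2l lerN2.
Qed.

End Box.

Lemma unit_box_sym n (U : 'M[C]_n) :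
  unit_box R n U -> unit_box R n (1%:M - U).
Proof. by case=> pU p1; split; [exact: p1 | rewrite subKr; exact: pU]. Qed.

Lemma unit_box_drsubmx m n (U : 'M[C]_(m + n)) :
  unit_box R (m + n) U -> unit_box R n (drsubmx U).
Proof.
move=> [pU p1U]; split; first exact: posdef_drsubmx.
suff -> : 1%:M - drsubmx U = drsubmx (1%:M - U) by exact: posdef_drsubmx.
by apply/matrixP => i j; rewrite !mxE eq_rshift.
Qed.

Lemma det_norm_le n (A : 'M[C]_n) (B : C) : (forall i j, `|A i j| <= B) ->
  `|\det A| <= n`!%:R * B ^+ n.
Proof.
move=> AB; rewrite /determinant (le_trans (ler_norm_sum _ _ _))//.
apply: (@le_trans _ _ (\sum_(s : 'S_n) B ^+ n)).
  apply: ler_sum => s _; rewrite normrM normrX normrN1 expr1n mul1r normr_prod.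
  rewrite -[n in B ^+ n]card_ord -prodr_const.
  by apply: ler_prod => i _; rewrite normr_ge0 AB.
by rewrite sumr_const -[B ^+ n *+ _]mulr_natl -(card_Sn n) (_ : #|'S_n| = #|{: 'S_n}|).
Qed.

(** Right multiplication by the unitriangular L clears the lower left block, which for Hermitian U
    is the adjoint of the row v. *)
Lemma det_schur n (U : 'M[C]_(1 + n)) : drsubmx U \in unitmx ->
  U^t* = U ->
  \det U = (U 0 0 - qform (invmx (drsubmx U)) (ursubmx U)) * \det (drsubmx U).
Proof.
move=> uU hU; set U' := drsubmx U; set v := ursubmx U.
have dl : dlsubmx U = v^t*.
  by rewrite -{1}hU -map_dlsubmx -trmx_ursub.
pose L : 'M[C]_(1 + n) := block_mx 1%:M 0 (- (invmx U' *m v^t*)) 1%:M.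
have UL : U *m L = block_mx (ulsubmx U - v *m invmx U' *m v^t*) v 0 U'.
  rewrite -{1}(submxK U) mulmx_block !mulmx1 !mulmx0 !add0r dl.
  by rewrite !mulmxN mulKVmx// subrr mulmxA.
have := congr1 determinant UL; rewrite det_mulmx det_lblock !det1 !mulr1 det_ublock.
by move=> ->; congr (_ * _); rewrite det_mx11 /qform !mxE !lshift0.
Qed.

(** One elimination step: congruence by L' splits off the pivot h, and the Schur complement A' is
    positive definite as a corner of a congruent matrix. With P lower unitriangular, entry i of v P
    involves only the v_j with j >= i. *)
Lemma posdef_LDL n (A : 'M[C]_n) : posdef A -> exists P (d : 'rV[C]_n),
  [/\ A = P *m diag_mx d *m P^t*, forall i j : 'I_n, (i < j)%N -> P i j = 0,
      forall i, P i i = 1 & forall i, 0 < d 0 i].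
Proof.
elim: n A => [|n IH] A pA.
  by exists 0, 0; split; [apply/matrixP => -[] | move=> [] | move=> [] | move=> []].
have {}pA : @posdef R (1 + n) A by [].
move: A pA; rewrite -[n.+1]/(1 + n)%N => A pA.
pose h := A 0 0; pose b : 'rV[C]_n := ursubmx A.
have h0 : 0 < h.
  have := @posdef_qform_gt0 _ _ (delta_mx 0 0) pA.
  rewrite /qform -rowE (_ : (delta_mx 0 0)^t* = delta_mx 0 0); last first.
    by apply/matrixP=> i j; rewrite !mxE conjC_nat andbC.
  rewrite -colE !mxE; apply; apply/eqP => /matrixP/(_ 0 0).
  by rewrite !mxE !eqxx => /eqP; rewrite oner_eq0.
have hC : (h^-1)^* = h^-1 by apply/CrealP; rewrite gtr0_real// invr_gt0.
have ul : ulsubmx A = h%:M by rewrite [LHS]mx11_scalar !mxE lshift0.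
have dl : dlsubmx A = b^t*.
  by rewrite -{1}(posdef_trmxC pA) -map_dlsubmx -trmx_ursub.
pose L : 'M[C]_(1 + n) := block_mx 1%:M 0 (h^-1 *: b^t*) 1%:M.
pose L' : 'M[C]_(1 + n) := block_mx 1%:M 0 (- (h^-1 *: b^t*)) 1%:M.
have LT : L^t* = block_mx 1%:M (h^-1 *: b) 0 1%:M.
  rewrite tr_block_mx map_block_mx !(trmx0, trmx1, map_mx0, map_mx1).
  by rewrite trmxCZ hC trmxCK.
have LT' : L'^t* = block_mx 1%:M (- (h^-1 *: b)) 0 1%:M.
  rewrite tr_block_mx map_block_mx !(trmx0, trmx1, map_mx0, map_mx1).
  by rewrite trmxCN trmxCZ hC trmxCK.
pose A' := drsubmx A - h^-1 *: (b^t* *m b).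
have LAL : L' *m A *m L'^t* = block_mx h%:M 0 0 A'.
  rewrite -(submxK A) -/b ul dl LT' !mulmx_block.
  rewrite !(mul0mx, mulmx0, mul1mx, mulmx1, addr0, add0r).
  rewrite !(mulmxN, mulNmx) -!scalemxAl -!scalemxAr mul_mx_scalar mul_scalar_mx.
  rewrite !scalerA ?mulVf ?divff ?gt_eqF// !scale1r ?addNr ?mul0mx ?oppr0 ?add0r.
  by rewrite scaler0 oppr0 add0r addrC.
have LLV : L *m L' = 1%:M.
  rewrite mulmx_block !(mul0mx, mulmx0, mul1mx, mulmx1, addr0, add0r) subrr.
  by rewrite -scalar_mx_block.
have pA' : posdef A'.
  rewrite -(block_mxKdr (h%:M : 'M[C]_1) 0 0 A') -LAL.
  apply/posdef_drsubmx/posdef_congr => // v /(congr1 (fun M => M *m L)).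
  by rewrite -mulmxA (mulmx1C LLV) mulmx1 mul0mx.
have [P [d [A'E P0 P1 d0]]] := IH _ pA'.
exists (block_mx 1%:M 0 (h^-1 *: b^t*) P), (row_mx h%:M d); split.
- have -> : A = L *m (L' *m A *m L'^t*) *m L^t*.
    rewrite !mulmxA LLV mul1mx -mulmxA -trmxC_mul LLV trmxC1 mulmx1.
    by [].
  rewrite LAL A'E LT diag_mx_row tr_block_mx map_block_mx.
  rewrite !(trmx0, trmx1, map_mx0, map_mx1).
  rewrite trmxCZ hC trmxCK !mulmx_block.
  rewrite !(mul0mx, mulmx0, mul1mx, mulmx1, addr0, add0r).
  by have -> : diag_mx (h%:M : 'rV[C]_1) = h%:M
    by apply/matrixP => i j; rewrite !mxE !ord1 eqxx.
- move=> i j ij; rewrite mxE; case: splitP => /= i' ii'; rewrite mxE;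
    case: splitP => /= j' jj'.
  + by move: ij; rewrite ii' jj' !ord1.
  + by rewrite mxE.
  + by move: ij; rewrite ii' jj' (ord1 j').
  + by rewrite P0//; move: ij; rewrite ii' jj' ltn_add2l.
- move=> i; rewrite mxE; case: splitP => /= i' ii'; rewrite mxE;
    case: splitP => /= j' jj'.
  + by rewrite !ord1 mxE.
  + by have := ltn_ord i'; rewrite -ii' jj'.
  + by have := ltn_ord j'; rewrite -jj' ii'.
  + by rewrite (_ : i' = j') ?P1//; apply/val_inj/eqP; rewrite -(eqn_add2l 1) -ii' jj'.
- move=> i; rewrite mxE; case: splitP => k _; last exact: d0.
  by rewrite mxE ord1 eqxx mulr1n.
Qed.

End Posdef.

(** * Lebesgue measure on tuples *)

Section TupleLebesgue.
Local Open Scope classical_set_scope.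
Variable R : realType.
Local Open Scope ereal_scope.
Local Notation lambda := (@lebesgue_measure R).
Local Notation mu := (tuple_lebesgue R).

(** The integral of a nonnegative function is a supremum over the simple functions below it, hence
    monotone without any measurability. This spares measurability proofs in all later
    comparisons. *)
Lemma ge0_le_integral_nonmeasurable d (T : measurableType d)
    (m : {measure set T -> \bar R}) (f g : T -> \bar R) :
  (forall x, 0 <= f x) -> (forall x, f x <= g x) ->
  \int[m]_x f x <= \int[m]_x g x.
Proof.
move=> f0 fg; have g0 x : 0 <= g x by exact: le_trans (f0 x) (fg x).
rewrite !ge0_integralTE//; apply: ereal_sup_le => _ [h hf <-].
by exists h => // x; exact: le_trans (hf x) (fg x).
Qed.

(** Uniqueness of Lebesgue measure reduces the claim to intervals ]a, b], whose preimage [c - b, c -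
    a[ has the same length. *)
Lemma lebesgue_measure_reflect (c : R) (A : set R) : measurable A ->
  lambda ((fun s => c - s)%R @^-1` A) = lambda A.
Proof.
have mc : measurable_fun [set: measurableTypeR R]
    (fun s : measurableTypeR R => c - s : measurableTypeR R)%R.
  by apply: measurable_funB => //; exact: measurable_cst.
move=> mA; apply/esym; apply: (@lebesgue_measure_unique R
  (measure_function_pushforward__canonical__measure_function_Measure
    lambda mc)) => //.
move=> _ [[a b]] _ <-; rewrite /pushforward.
rewrite [X in _ = lambda X](_ : _ = `[(c - b)%R, (c - a)%R[%classic); last first.
  apply/seteqP; split=> s /=; rewrite !in_itv/= => /andP[s1 s2].
    by rewrite lerBlDr -lerBlDl s2 ltrBrDr -ltrBrDl.
  by rewrite ltrBrDr -ltrBrDl s2 lerBlDr -lerBlDl.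
rewrite !lebesgue_measure_itv/= !lte_fin ltrD2l ltrN2.
case: ifP => // _; rewrite -!EFinB; congr EFin; ring.
Qed.

Lemma ge0_integral_reflect (c : R) (f : R -> \bar R) :
  measurable_fun [set: R] f -> (forall s, 0 <= f s) ->
  \int[lambda]_s f (c - s)%R = \int[lambda]_s f s.
Proof.
move=> mf f0.
have mc : measurable_fun [set: R]
    (fun s : measurableTypeR R => c - s : measurableTypeR R)%R.
  by apply: measurable_funB => //; exact: measurable_cst.
have := @ge0_integral_pushforward _ _ (measurableTypeR R) (measurableTypeR R) R
  _ mc lambda [set: R] f measurableT mf.
rewrite preimage_setT => <-; last by move=> ? _; exact: f0.
by apply: eq_measure_integral => A mA _; exact: lebesgue_measure_reflect.
Qed.

Lemma ge0_integral_cons n (f : n.+1.-tuple R -> \bar R) :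
  measurable_fun [set: _] f -> (forall t, 0 <= f t) ->
  \int[mu n.+1]_t f t = \int[lambda]_s \int[mu n]_t f (cons_pair (s, t)).
Proof.
move=> mf f0.
have := @ge0_integral_pushforward _ _ (measurableTypeR R * n.-tuple R)%type _ R
  _ (@measurable_cons_pair R n) (lambda \x mu n) _ f measurableT mf.
rewrite preimage_setT => /= ->; last by move=> ? _; exact: f0.
apply: (@fubini_tonelli1 _ _ (measurableTypeR R) (n.-tuple R)%type R
  lambda (mu n) (f \o @cons_pair R n)).
  by apply: measurableT_comp => //; exact: measurable_cons_pair.
by move=> p; exact: f0.
Qed.

Lemma ge0_integral_cons_swap n (f : n.+1.-tuple R -> \bar R) :
  measurable_fun [set: _] f -> (forall t, 0 <= f t) ->
  \int[mu n.+1]_t f t = \int[mu n]_t \int[lambda]_s f (cons_pair (s, t)).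
Proof.
move=> mf f0; rewrite ge0_integral_cons//.
apply: (@fubini_tonelli _ _ (measurableTypeR R) (n.-tuple R)%type R
  lambda (mu n) (f \o @cons_pair R n)).
  by apply: measurableT_comp => //; exact: measurable_cons_pair.
by move=> p; exact: f0.
Qed.

(** The centre depends on the coordinate: U |-> 1 - U acts by s |-> 1 - s on diagonal entries and by
    s |-> - s on all other coordinates. *)
Definition reflect_tuple n (c : 'I_n -> R) (t : n.-tuple R) : n.-tuple R :=
  [tuple (c i - tnth t i)%R | i < n].

Lemma measurable_reflect_tuple n (c : 'I_n -> R) :
  measurable_fun [set: n.-tuple R] (reflect_tuple c).
Proof.
apply/measurable_fun_tnthP => i.
rewrite (_ : _ \o _ = fun t => c i - tnth t i)%R; last first.
  by apply/funext => t /=; rewrite tnth_mktuple.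
by apply: measurable_funB; [exact: measurable_cst | exact: measurable_tnth].
Qed.

Lemma reflect_tuple_cons n (c : 'I_n.+1 -> R) (s : R) (t : n.-tuple R) :
  reflect_tuple c (cons_pair (s, t)) =
  cons_pair (c ord0 - s, reflect_tuple (c \o lift ord0) t)%R.
Proof.
apply: eq_from_tnth => i; rewrite tnth_mktuple /cons_pair.
by case: (unliftP ord0 i) => [j|] ->; rewrite ?tnthS ?tnth0// tnth_mktuple.
Qed.

Lemma ge0_integral_reflect_tuple n (c : 'I_n -> R) (f : n.-tuple R -> \bar R) :
  measurable_fun [set: _] f -> (forall t, 0 <= f t) ->
  \int[mu n]_t f (reflect_tuple c t) = \int[mu n]_t f t.
Proof.
elim: n c f => [|n IH] c f mf f0.
  by apply: eq_integral => t _; congr f; apply: eq_from_tnth => -[].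
have mfc : measurable_fun [set: R * n.-tuple R] (f \o @cons_pair R n).
  by apply: measurableT_comp => //; exact: measurable_cons_pair.
rewrite !ge0_integral_cons//; last first.
  by apply: measurableT_comp => //; exact: measurable_reflect_tuple.
under eq_integral.
  move=> s _; under eq_integral do rewrite reflect_tuple_cons.
  rewrite (IH _ (fun t => f (cons_pair (c ord0 - s, t)%R)))//; last first.
    apply: (measurableT_comp mfc).
    exact: measurable_fun_pair.
  over.
apply: (ge0_integral_reflect (c ord0)
  (f := fun s => \int[mu n]_x f (cons_pair (s, x)))); last first.
  by move=> s; exact: integral_ge0.
apply: (@measurable_fun_fubini_tonelli_F _ _ (measurableTypeR R)
  (n.-tuple R)%type R (mu n) (f \o @cons_pair R n)) => // p; exact: f0.
Qed.

Definition upd n (t : n.-tuple R) (i : 'I_n) (s : R) : n.-tuple R :=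
  [tuple if j == i then s else tnth t j | j < n].

Lemma measurable_upd n (i : 'I_n) :
  measurable_fun [set: n.-tuple R * R] (fun p => upd p.1 i p.2).
Proof.
apply/measurable_fun_tnthP => j.
rewrite (_ : _ \o _ = fun p : n.-tuple R * R =>
  if j == i then p.2 else tnth p.1 j); last first.
  by apply/funext => p /=; rewrite tnth_mktuple.
case: eqP => _; first exact: measurable_snd.
exact: (measurableT_comp (measurable_tnth j) measurable_fst).
Qed.

(** The result remains a function of the whole tuple, constant in coordinate i, so that integrations
    over several coordinates compose without a change of type. *)
Definition integ n (i : 'I_n) (f : n.-tuple R -> \bar R) (t : n.-tuple R) :=
  \int[lambda]_s f (upd t i s).

Lemma integ_ge0 n (i : 'I_n) f :
  (forall t, 0 <= f t) -> forall t, 0 <= integ i f t.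
Proof. by move=> f0 t; exact: integral_ge0. Qed.

Lemma measurable_integ n (i : 'I_n) f : measurable_fun [set: _] f ->
  (forall t, 0 <= f t) -> measurable_fun [set: _] (integ i f).
Proof.
move=> mf f0.
apply: (@measurable_fun_fubini_tonelli_F _ _ (n.-tuple R)%type
  (measurableTypeR R) R lambda (fun p => f (upd p.1 i p.2))) => //.
by apply: measurableT_comp => //; exact: measurable_upd.
Qed.

(** The indicator of [-1, 1]^n. It equals 1 on the unit box, whose matrix entries have modulus at
    most 1, and provides finite volume for the coordinates that are never integrated explicitly. *)
Definition cube n (t : n.-tuple R) : R :=
  (\prod_(i < n) \1_(`[(-1)%R, 1%R]%classic : set R) (tnth t i))%R.

Lemma cube_ge0 n t : (0 <= @cube n t)%R.
Proof. by apply: prodr_ge0 => i _; rewrite indicE ler0n. Qed.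

Lemma indic_ge0_le1 (A : set R) s : (0 <= (\1_A s : R) <= 1)%R.
Proof. by rewrite indicE ler0n lern1 leq_b1. Qed.

Lemma cube_cons n s (t : n.-tuple R) :
  cube (cons_pair (s, t)) = (\1_(`[(-1)%R, 1%R]%classic : set R) s * cube t)%R.
Proof.
rewrite /cube big_ord_recl tnth0; congr (_ * _)%R.
by apply: eq_bigr => i _; rewrite tnthS.
Qed.

Lemma measurable_cube n : measurable_fun [set: n.-tuple R] (@cube n).
Proof.
apply: measurable_prod => i _.
apply: measurableT_comp; last exact: measurable_tnth.
exact: measurable_indic.
Qed.

Lemma integral_interval :
  \int[lambda]_s (\1_(`[(-1)%R, 1%R]%classic : set R) s)%:E = 2%:E.
Proof.
rewrite integral_indic// setIT /= lebesgue_measure_itv/= lte_fin.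
by rewrite (lt_trans (ltrN10 R) ltr01) -EFinB opprK.
Qed.

Lemma cube_integral_fin n : \int[mu n]_t (cube t)%:E < +oo.
Proof.
elim: n => [|n IH].
  rewrite (_ : (fun _ => _) = cst 1); last first.
    by apply/funext => t; rewrite /cube big_ord0.
  by rewrite integral_cst// mul1e /= diracE mem_set// ltry.
rewrite ge0_integral_cons; last 2 first.
- by apply/measurable_EFinP; exact: measurable_cube.
- by move=> t; rewrite lee_fin cube_ge0.
have c0 (t : n.-tuple R) : 0 <= (cube t)%:E by rewrite lee_fin cube_ge0.
have i0 s : 0 <= (\1_(`[(-1)%R, 1%R]%classic : set R) s)%:E.
  by rewrite lee_fin indicE ler0n.
have mc : measurable_fun [set: n.-tuple R] (fun t => (cube t)%:E).
  by apply/measurable_EFinP; exact: measurable_cube.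
have E s : \int[mu n]_t (cube (cons_pair (s, t)))%:E =
    (\1_(`[(-1)%R, 1%R]%classic : set R) s)%:E * \int[mu n]_t (cube t)%:E.
  under eq_integral do rewrite cube_cons EFinM.
  by rewrite ge0_integralZl_EFin.
under eq_integral do rewrite E.
rewrite ge0_integralZr//; last exact: integral_ge0.
  by rewrite integral_interval lte_mul_pinfty.
by apply/measurable_EFinP; exact: measurable_indic.
Qed.

(* The side 2 of the cube is at least 1: replacing f by its integral over one
   coordinate does not decrease the integral over the cube.  This makes it
   possible to integrate the coordinates in any order. *)
Lemma integral_cube_le n (i : 'I_n) (f : n.-tuple R -> \bar R) :
  measurable_fun [set: _] f -> (forall t, 0 <= f t) ->
  \int[mu n]_t ((cube t)%:E * f t) <= \int[mu n]_t ((cube t)%:E * integ i f t).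
Proof.
elim: n i f => [[]//|n IH] i f mf f0.
have mfc : measurable_fun [set: R * n.-tuple R] (f \o @cons_pair R n).
  by apply: measurableT_comp => //; exact: measurable_cons_pair.
have mcE m : measurable_fun [set: m.-tuple R] (EFin \o @cube m).
  by apply/measurable_EFinP; exact: measurable_cube.
have mi : measurable_fun [set: measurableTypeR R]
    (EFin \o (\1_(`[(-1)%R, 1%R]%classic : set (measurableTypeR R)) :
      measurableTypeR R -> R)).
  exact: measurableT_comp.
have m1 : measurable_fun [set: _] (fun t => (cube t)%:E * f t).
  by apply: emeasurable_funM => //; exact: mcE.
have m2 : measurable_fun [set: _] (fun t => (cube t)%:E * integ i f t).
  by apply: emeasurable_funM; [exact: mcE | exact: measurable_integ].
have p1 t : 0 <= (cube t)%:E * f t by rewrite mule_ge0// lee_fin cube_ge0.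
have p2 t : 0 <= (cube t)%:E * integ i f t.
  by rewrite mule_ge0// ?lee_fin ?cube_ge0// integ_ge0.
have mfs s : measurable_fun [set: n.-tuple R] (fun t => f (cons_pair (s, t))).
  by apply: (measurableT_comp mfc); exact: measurable_fun_pair.
have mft t : measurable_fun [set: R] (fun s => f (cons_pair (s, t))).
  by apply: (measurableT_comp mfc); exact: measurable_fun_pair.
(* If i is not the first coordinate, the induction hypothesis is applied on each slice s. If it is,
   the order is exchanged by Tonelli: the inner integral F no longer depends on s, and the first
   side contributes the factor 2 >= 1. *)
case: (unliftP ord0 i) => [j ij|i0].
  rewrite !ge0_integral_cons//; apply: ge0_le_integral_nonmeasurable.
    by move=> s; exact: integral_ge0.
  move=> s; under eq_integral do rewrite cube_cons EFinM -muleA.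
  under [leRHS]eq_integral do rewrite cube_cons EFinM -muleA.
  have /andP[i1 _] := indic_ge0_le1 (`[(-1)%R, 1%R]%classic) s.
  have uE t s' : upd (cons_pair (s, t)) i s' = cons_pair (s, upd t j s').
    apply: eq_from_tnth => k; rewrite tnth_mktuple /cons_pair ij.
    case: (unliftP ord0 k) => [l|] ->; rewrite ?tnthS ?tnth0// tnth_mktuple.
    by rewrite (inj_eq lift_inj).
  have iE t : integ i f (cons_pair (s, t)) =
      integ j (fun t => f (cons_pair (s, t))) t.
    by apply: eq_integral => s' _; rewrite uE.
  under [leRHS]eq_integral do rewrite iE.
  rewrite !ge0_integralZl_EFin//; last 4 first.
  - by move=> t _; rewrite mule_ge0// ?lee_fin ?cube_ge0// integ_ge0.
  - by apply: emeasurable_funM; [exact: mcE | exact: measurable_integ].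
  - by move=> t _; rewrite mule_ge0// lee_fin cube_ge0.
  - by apply: emeasurable_funM => //; exact: mcE.
  by rewrite lee_wpmul2l ?lee_fin// IH.
pose F t := \int[lambda]_s f (cons_pair (s, t)).
have F0 t : 0 <= F t by exact: integral_ge0.
have iE s t : integ i f (cons_pair (s, t)) = F t.
  apply: eq_integral => s' _; congr f; apply: eq_from_tnth => k.
  rewrite tnth_mktuple /cons_pair i0.
  by case: (unliftP ord0 k) => [l|] ->; rewrite ?tnthS ?tnth0.
rewrite !ge0_integral_cons_swap//; apply: ge0_le_integral_nonmeasurable.
  by move=> t; exact: integral_ge0.
move=> t; under eq_integral do rewrite cube_cons EFinM -muleA.
under [leRHS]eq_integral do rewrite cube_cons iE EFinM -muleA.
apply: (@le_trans _ _ ((cube t)%:E * F t)).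
  rewrite -ge0_integralZl_EFin//; [|exact: mft|exact: cube_ge0].
  apply: ge0_le_integral_nonmeasurable => s.
    by rewrite !mule_ge0// lee_fin ?cube_ge0// indicE ler0n.
  rewrite -[leRHS]mul1e lee_wpmul2r//.
    by rewrite mule_ge0// lee_fin cube_ge0.
  by rewrite lee_fin indicE lern1 leq_b1.
have cF0 : 0 <= (cube t)%:E * F t by rewrite mule_ge0// lee_fin cube_ge0.
rewrite ge0_integralZr//.
rewrite integral_interval -[leLHS]mul1e lee_wpmul2r//.
by rewrite lee_fin ler1n.
Qed.

(** Each step along l can only enlarge the integral over the cube, so a uniform bound on the
    iterated integral suffices: the remaining integral is at most a constant times the volume of the
    cube. *)
Lemma integral_cube_lt_pinfty n (l : seq 'I_n) (f : n.-tuple R -> \bar R) (K : R) :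
  measurable_fun [set: _] f -> (forall t, 0 <= f t) ->
  (forall t, foldl (fun g i => integ i g) f l t <= K%:E) ->
  \int[mu n]_t ((cube t)%:E * f t) < +oo.
Proof.
elim: l f => [|i l IH] f mf f0 fK.
  apply: (@le_lt_trans _ _ (\int[mu n]_t ((cube t)%:E * `|K|%:E))).
    apply: ge0_le_integral_nonmeasurable => t.
      by rewrite mule_ge0// lee_fin cube_ge0.
    rewrite lee_wpmul2l ?lee_fin ?cube_ge0// (le_trans (fK t))// lee_fin.
    exact: ler_norm.
  have c0 (t : n.-tuple R) : 0 <= (cube t)%:E by rewrite lee_fin cube_ge0.
  rewrite ge0_integralZr//; last first.
    by apply/measurable_EFinP; exact: measurable_cube.
  have i0 : 0 <= \int[mu n]_t (cube t)%:E by exact: integral_ge0.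
  by rewrite lte_mul_pinfty ?ge0_fin_numE ?cube_integral_fin ?ltry.
apply: le_lt_trans (IH (integ i f) _ _ fK).
- exact: integral_cube_le.
- exact: measurable_integ.
- exact: integ_ge0.
Qed.

End TupleLebesgue.

(** * Beta integrals *)

Section Beta.
Local Open Scope classical_set_scope.
Variable R : realType.
Local Notation lambda := (@lebesgue_measure R).

(* Extended by 0 to x <= 0, where powR takes junk values. *)
Definition ppow (p x : R) : R := if 0 < x then x `^ p else 0.

Lemma ppow_ge0 p x : 0 <= ppow p x.
Proof. by rewrite /ppow; case: ifP => // _; exact: powR_ge0. Qed.

Lemma ppowE p x : 0 < x -> ppow p x = x `^ p.
Proof. by rewrite /ppow => ->. Qed.

Lemma ppow0 p x : x <= 0 -> ppow p x = 0.
Proof. by rewrite /ppow ltNge => ->. Qed.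

Lemma measurable_ppow p : measurable_fun [set: R] (ppow p).
Proof.
by apply: measurable_fun_ifT;
  [exact: measurable_fun_ltr | exact: measurable_powR |].
Qed.

Lemma powR_derivable_continuous p (x : R) : 0 < x ->
  derivable (@powR R ^~ p) x 1 /\ {for x, continuous (@powR R ^~ p)}.
Proof.
move=> x0; have d : derivable (@powR R ^~ p) x 1.
  by apply: derivable_powR; rewrite in_itv/= x0.
by split=> //; apply/differentiable_continuous/derivable1_diffP.
Qed.

(** For p < 0 the integral is improper at 0, so ]0, h] is exhausted by the intervals
    [h / (n + 2), h]; the fundamental theorem applies on each and monotone convergence concludes.
    The shift by 2 keeps the left end below h already for n = 0. *)
Lemma integral_powR_le (p h : R) : -1 < p -> 0 < h ->
  (\int[lambda]_(s in `]0%R, h]) (s `^ p)%:E <= (h `^ (p + 1) / (p + 1))%:E)%E.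
Proof.
move=> p1 h0; have p10 : 0 < p + 1 by lra.
pose e n : R := h / n.+2%:R.
have e0 n : 0 < e n by rewrite divr_gt0.
have eh n : e n < h by rewrite ltr_pdivrMr// ltr_pMr// ltr1n.
pose F n : set R := `[e n, h]%classic.
have UF : `]0, h]%classic = \bigcup_n F n.
  apply/seteqP; split=> [s|s [n _]]; rewrite /F/= !in_itv/= => /andP[s0 sh]; last first.
    by rewrite sh andbT (lt_le_trans (e0 n)).
  exists (Num.truncn (h / s)) => //=; rewrite in_itv/= sh andbT.
  rewrite ler_pdivrMr// mulrC -ler_pdivrMr//.
  have := truncnS_gt (h / s) => /ltW/le_trans; apply.
  by rewrite ler_nat.
have mF n : measurable (F n) by exact: measurable_itv.
have mp D : measurable_fun D (fun s : R => (s `^ p)%:E).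
  by apply/measurable_EFinP/measurable_funTS; exact: measurable_powR.
have ndF : nondecreasing_seq F.
  move=> m n mn; apply/subsetPset => s; rewrite /F/= !in_itv/= => /andP[s1 ->].
  rewrite andbT (le_trans _ s1)// ler_pM2l// lef_pV2 ?posrE ?ltr0n//.
  by rewrite ler_nat !ltnS.
have G n : (\int[lambda]_(s in F n) (s `^ p)%:E <= (h `^ (p + 1) / (p + 1))%:E)%E.
  rewrite (@continuous_FTC2 _ (@powR R ^~ p) (fun s => (p + 1)^-1 *: (s `^ (p + 1))))//.
  - rewrite -EFinB lee_fin /GRing.scale/= [leRHS]mulrC gerBl.
    by rewrite mulr_ge0 ?powR_ge0// invr_ge0 ltW.
  - apply: continuous_in_subspaceT => s; rewrite inE/= in_itv/= => /andP[s0 _].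
    by have [_] := powR_derivable_continuous p (lt_le_trans (e0 n) s0).
  - have c s : 0 < s ->
        {for s, continuous (fun s : R => (p + 1)^-1 *: s `^ (p + 1))}.
      move=> s0; apply: cvgZr.
      by have [_] := powR_derivable_continuous (p + 1) s0.
    split.
    + move=> s; rewrite in_itv/= => /andP[s0 _]; apply: derivableZ.
      by have [] := powR_derivable_continuous (p + 1) (lt_trans (e0 n) s0).
    + by apply: cvg_at_right_filter; exact: c.
    + by apply: cvg_at_left_filter; exact: c.
  - move=> s; rewrite in_itv/= => /andP[/(lt_trans (e0 n)) s0 _].
    rewrite derive1E deriveZ; last first.
      by have [] := powR_derivable_continuous (p + 1) s0.
    rewrite -derive1E powR_derive1 ?in_itv/= ?s0// addrK /GRing.scale/= mulrA.
    by rewrite mulVf ?mul1r// gt_eqF.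
rewrite UF; have cv := ge0_nondecreasing_set_cvg_integral (mu := lambda) ndF mF
  (fun n => mp (F n)) (fun n (x : R) _ => powR_ge0 x p).
rewrite -(cvg_lim _ cv)//; apply: lime_le; first by apply/cvg_ex; eexists; exact: cv.
by near=> n; exact: G.
Unshelve. all: by end_near. Qed.

(** The truncation is put into the function so that the integral runs over the whole line, where
    translation and reflection invariance apply. *)
Definition tpow (p h s : R) : R := \1_(`]0, h]%classic : set R) s * s `^ p.

Lemma tpow_ge0 p h s : 0 <= tpow p h s.
Proof. by rewrite mulr_ge0 ?powR_ge0// indicE ler0n. Qed.

Lemma measurable_tpow p h : measurable_fun [set: R] (tpow p h).
Proof.
apply: measurable_funM; last exact: measurable_powR.
exact: measurable_indic.
Qed.

Lemma integral_tpow_le (p h : R) : -1 < p -> 0 < h ->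
  (\int[lambda]_s (tpow p h s)%:E <= (h `^ (p + 1) / (p + 1))%:E)%E.
Proof.
move=> p1 h0; rewrite (le_trans _ (integral_powR_le p1 h0))//.
rewrite [leRHS]integral_mkcond/= le_eqVlt; apply/orP; left; apply/eqP.
apply: eq_integral => s _; rewrite /tpow indicE patchE.
by case: ifP => _; rewrite ?mul1r ?mul0r.
Qed.

(** A translation is the composite of two reflections. *)
Lemma ge0_integral_translate (c : R) (f : R -> \bar R) :
  measurable_fun [set: R] f -> (forall s, (0 <= f s)%E) ->
  (\int[lambda]_s f (s - c)%R = \int[lambda]_s f s)%E.
Proof.
move=> mf f0.
rewrite -(@ge0_integral_reflect R 0 f)//.
rewrite -(@ge0_integral_reflect R c (fun s => f (0 - s)))//; last first.
  apply: (measurableT_comp mf).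
  by apply: measurable_funB => //; exact: measurable_cst.
by apply: eq_integral => s _; congr f; rewrite sub0r opprB.
Qed.

(** The factor 1 + 2^p covers both signs of p: the ratio is at most 2^p for p >= 0 and at most 1 for
    p <= 0. *)
Lemma powR_doubling (p h x : R) : 0 < h -> h <= x <= h + h ->
  x `^ p <= (1 + 2 `^ p) * h `^ p.
Proof.
move=> h0 /andP[hx x2].
have -> : x = (x / h) * h by rewrite mulfVK// gt_eqF.
have y1 : 1 <= x / h by rewrite ler_pdivlMr// mul1r.
have y2 : x / h <= 2 by rewrite ler_pdivrMr// mulr_natl mulr2n.
rewrite powRM ?(le_trans _ y1)// ?(ltW h0)// ler_wpM2r ?powR_ge0//.
have [p0|/ltW p0] := leP 0 p.
  rewrite (@le_trans _ _ (2 `^ p))// ?lerDr//.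
  by apply: ge0_ler_powR; rewrite ?nnegrE// (le_trans ler01).
rewrite (@le_trans _ _ 1)// ?lerDl ?powR_ge0//.
by rewrite -[leRHS](powRr0 (x / h)) ler_powR.
Qed.

(** The interval ]A, B[ is cut at its midpoint, with half-length h. On the left half B - s lies in
    [h, 2h], so its power is comparable to h^q and only (s - A)^p is integrated; the right half is
    symmetric. Both give a multiple of h^(p + q + 1). *)
Lemma integral_beta_le (p q : R) : -1 < p -> -1 < q -> exists2 K : R, 0 <= K &
  forall A B, (\int[lambda]_s (ppow p (s - A) * ppow q (B - s))%:E <=
    (K * ppow (p + q + 1) (B - A))%:E)%E.
Proof.
move=> p1 q1; have p10 : 0 < p + 1 by lra.
have q10 : 0 < q + 1 by lra.
pose K0 : R := (1 + 2 `^ q) / (p + 1) + (1 + 2 `^ p) / (q + 1).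
have P2 (x : R) : 0 <= 1 + 2 `^ x by rewrite addr_ge0// powR_ge0.
have K00 : 0 <= K0 by rewrite /K0 addr_ge0 ?divr_ge0 ?P2// ltW.
(* The power of 1/2 converts h^(p + q + 1) into (B - A)^(p + q + 1). *)
exists (K0 * 2^-1 `^ (p + q + 1)); first by rewrite mulr_ge0// powR_ge0.
move=> A B; have [BA|AB] := leP B A.
  rewrite [X in (X <= _)%E](_ : _ = 0)%E; last first.
    apply: integral0_eq => s _; congr EFin.
    have [sA|As] := leP s A; first by rewrite (@ppow0 p) ?mul0r// subr_le0.
    by rewrite (@ppow0 q) ?mulr0// subr_le0 (le_trans BA)// ltW.
  by rewrite lee_fin !mulr_ge0 ?powR_ge0// ppow_ge0.
pose h := (B - A) / 2; have h0 : 0 < h by rewrite divr_gt0// subr_gt0.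
have BAh : B - A = h + h by rewrite /h -splitr.
pose Kq := (1 + 2 `^ q) * h `^ q; pose Kp := (1 + 2 `^ p) * h `^ p.
have Kq0 : 0 <= Kq by rewrite mulr_ge0 ?addr_ge0 ?powR_ge0.
have Kp0 : 0 <= Kp by rewrite mulr_ge0 ?addr_ge0 ?powR_ge0.
apply: (@le_trans _ _ (\int[lambda]_s
    (Kq%:E * (tpow p h (s - A))%:E + Kp%:E * (tpow q h (B - s))%:E)%E)%E).
  apply: ge0_le_integral_nonmeasurable => s.
    by rewrite lee_fin mulr_ge0 ?ppow_ge0.
  rewrite -!EFinM -EFinD lee_fin.
  have [sA|As] := leP s A.
    rewrite (@ppow0 p) ?mul0r ?subr_le0//.
    by rewrite addr_ge0// mulr_ge0// tpow_ge0.
  have [Bs|sB] := leP B s.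
    rewrite (@ppow0 q) ?mulr0 ?subr_le0//.
    by rewrite addr_ge0// mulr_ge0// tpow_ge0.
  rewrite !ppowE ?subr_gt0//; have [sM|Ms] := leP (s - A) h.
    rewrite -[leLHS]addr0 lerD ?(mulr_ge0 Kp0 (tpow_ge0 _ _ _))//.
    rewrite /tpow indicE mem_set ?mul1r; last by rewrite /= in_itv/= sM subr_gt0 As.
    rewrite mulrC ler_wpM2r ?powR_ge0//; apply: powR_doubling => //.
    by apply/andP; split; lra.
  rewrite -[leLHS]add0r lerD ?(mulr_ge0 Kq0 (tpow_ge0 _ _ _))//.
  rewrite /tpow indicE mem_set ?mul1r; last first.
    by rewrite /= in_itv/= subr_gt0 sB/=; lra.
  rewrite ler_wpM2r ?powR_ge0//; apply: powR_doubling => //.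
  by apply/andP; split; lra.
have mtp c r : measurable_fun [set: R] (fun s => (tpow r h (s - c))%:E).
  apply/measurable_EFinP; apply: (measurableT_comp (measurable_tpow r h)).
  by apply: measurable_funB => //; exact: measurable_cst.
have mtq c r : measurable_fun [set: R] (fun s => (tpow r h (c - s))%:E).
  apply/measurable_EFinP; apply: (measurableT_comp (measurable_tpow r h)).
  by apply: measurable_funB => //; exact: measurable_cst.
have mt r : measurable_fun [set: R] (fun s => (tpow r h s)%:E).
  by apply/measurable_EFinP; exact: measurable_tpow.
have t0 r s : (0 <= (tpow r h s)%:E)%E by rewrite lee_fin tpow_ge0.
rewrite ge0_integralD//; first last.
- by apply: emeasurable_funM => //; exact: mtq.
- by move=> s _; rewrite mule_ge0.
- by apply: emeasurable_funM => //; exact: mtp.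
- by move=> s _; rewrite mule_ge0.
rewrite !ge0_integralZl_EFin//; [|exact: mtq|exact: mtp].
rewrite (ge0_integral_translate A (f := fun s => (tpow p h s)%:E))//.
rewrite (ge0_integral_reflect B (f := fun s => (tpow q h s)%:E))//.
apply: (@le_trans _ _ (Kq%:E * (h `^ (p + 1) / (p + 1))%:E +
    Kp%:E * (h `^ (q + 1) / (q + 1))%:E)%E).
  by apply: leeD; rewrite lee_wpmul2l ?lee_fin// integral_tpow_le.
rewrite -!EFinM -EFinD lee_fin ppowE ?subr_gt0// le_eqVlt; apply/orP; left.
rewrite -mulrA -powRM ?invr_ge0 ?subr_ge0 ?(ltW AB)//.
rewrite (mulrC 2^-1) -/h mulrDl.
have h00 : h != 0 by rewrite gt_eqF.
have E1 : h `^ (p + q + 1) = h `^ q * h `^ (p + 1).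
  by rewrite -powRD ?h00 ?implybT//; congr (_ `^ _); ring.
have E2 : h `^ (p + q + 1) = h `^ p * h `^ (q + 1).
  by rewrite -powRD ?h00 ?implybT//; congr (_ `^ _); ring.
rewrite {1}E1 E2 /Kq /Kp; apply/eqP; congr (_ + _); field.
- by rewrite gt_eqF.
- by rewrite gt_eqF.
Qed.

Lemma mulr_addr_gt0 (u v : R) : 0 < u + v -> 0 < u * v -> 0 < u /\ 0 < v.
Proof.
move=> uv; have [u0|u0] := ltP 0 u; first by rewrite pmulr_rgt0.
have v0 : 0 < v by lra.
by rewrite pmulr_lgt0// ltNge u0.
Qed.

(** With rho = sqrt (L / d) the base factors as d (s - (y - rho)) ((y + rho) - s), a beta integrand
    with p = q = k on an interval of length 2 rho. Then d^k rho^(2k + 1) = d^(-1/2) L^(k + 1/2). *)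
Lemma integral_quadratic_le k : -1 < k -> exists2 K : R, 0 <= K &
  forall d L y, 0 < d -> (\int[lambda]_s (ppow k (L - d * (s - y) ^+ 2))%:E <=
    (K * d `^ (- 2^-1) * ppow (k + 2^-1) L)%:E)%E.
Proof.
move=> k1; have [K K0 HK] := integral_beta_le k1 k1.
exists (K * 2 `^ (k + k + 1)); first by rewrite mulr_ge0// powR_ge0.
move=> d L y d0; have [L0|L0] := leP L 0.
  rewrite [X in (X <= _)%E](_ : _ = 0)%E; last first.
    apply: integral0_eq => s _; congr EFin; rewrite ppow0// subr_le0.
    by rewrite (le_trans L0)// mulr_ge0 ?sqr_ge0 ?ltW.
  by rewrite lee_fin !mulr_ge0 ?powR_ge0// ppow_ge0.
pose rho := (L / d) `^ 2^-1.
have Ld : 0 < L / d by rewrite divr_gt0.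
have rho0 : 0 < rho by rewrite powR_gt0.
have rho2 : rho ^+ 2 = L / d by rewrite /rho powR12_sqrt ?ltW// sqr_sqrtr ?ltW.
have LE s : L - d * (s - y) ^+ 2 = d * ((s - (y - rho)) * ((y + rho) - s)).
  have -> : (s - (y - rho)) * (y + rho - s) = rho ^+ 2 - (s - y) ^+ 2 by ring.
  by rewrite rho2 mulrBr (mulrC L) mulVKf// gt_eqF.
apply: (@le_trans _ _ (\int[lambda]_s ((d `^ k)%:E *
    (ppow k (s - (y - rho)) * ppow k ((y + rho) - s))%:E)%E)%E).
  apply: ge0_le_integral_nonmeasurable => s; first by rewrite lee_fin ppow_ge0.
  rewrite -EFinM lee_fin LE; have [uv|uv] := leP ((s - (y - rho)) * (y + rho - s)) 0.
    rewrite (@ppow0 k (d * _)); last by rewrite pmulr_rle0.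
    by apply: mulr_ge0; [exact: powR_ge0 | apply: mulr_ge0; exact: ppow_ge0].
  have [u0 v0] : 0 < s - (y - rho) /\ 0 < y + rho - s.
    apply: mulr_addr_gt0 uv.
    by rewrite (_ : _ + _ = rho + rho) ?addr_gt0//; ring.
  by rewrite !ppowE ?mulr_gt0// powRM ?(ltW d0) ?(ltW uv)// powRM// ltW.
rewrite ge0_integralZl_EFin//; last first.
- exact: powR_ge0.
- apply/measurable_EFinP; apply: measurable_funM.
    apply: (measurableT_comp (measurable_ppow k)).
    by apply: measurable_funB => //; exact: measurable_cst.
  apply: (measurableT_comp (measurable_ppow k)).
  by apply: measurable_funB => //; exact: measurable_cst.
- by move=> s _; rewrite lee_fin mulr_ge0 ?ppow_ge0.
apply: (@le_trans _ _ ((d `^ k)%:E * (K * ppow (k + k + 1) (y + rho - (y - rho)))%:E)%E).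
  by rewrite lee_wpmul2l ?lee_fin ?powR_ge0// HK.
have -> : y + rho - (y - rho) = 2 * rho by ring.
rewrite -EFinM lee_fin !ppowE ?mulr_gt0//.
have -> : (2 * rho) `^ (k + k + 1) =
    2 `^ (k + k + 1) * (L `^ (k + 2^-1) * d `^ (- (k + 2^-1))) :> R.
  rewrite powRM ?(ltW rho0)//; congr (_ * _); rewrite /rho -powRrM.
  have -> : 2^-1 * (k + k + 1) = k + 2^-1 by field.
  rewrite powRM ?(ltW L0) ?invr_ge0 ?(ltW d0)//; congr (_ * _).
  by rewrite -powR_inv1 ?(ltW d0)// -powRrM mulN1r.
have -> : d `^ (- 2^-1) = d `^ k * d `^ (- (k + 2^-1)).
  by rewrite -powRD ?(gt_eqF d0) ?implybT//; congr (_ `^ _); ring.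
by rewrite le_eqVlt; apply/orP; left; apply/eqP; ring.
Qed.

End Beta.

(** * Measurability *)

Section PosdefChar.
Local Open Scope classical_set_scope.
Local Open Scope sesquilinear_scope.
Variable R : realType.
Local Notation C := R[i].

Lemma coef_prod_XsubC_sign (s : seq C) i : (forall z, z \in s -> 0 < z) ->
  (i <= size s)%N ->
  0 < (-1) ^+ (size s + i) * (\prod_(z <- s) ('X - z%:P))`_i.
Proof.
elim: s i => [|z s IH] i s0 /=.
  by rewrite leqn0 => /eqP ->; rewrite big_nil expr0 mul1r coefC eqxx.
have z0 : 0 < z by rewrite s0// mem_head.
have {}s0 y : y \in s -> 0 < y by move=> ys; rewrite s0// inE ys orbT.
rewrite big_cons mulrBl coefB coefCM coefXM mulrBr => ils.
have e1 : (-1) ^+ ((size s).+1 + i) = - (-1) ^+ (size s + i) :> C.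
  by rewrite addSn exprS mulN1r.
case: i ils e1 => [|i] ils e1 /=.
  rewrite mulr0 sub0r e1 mulNr opprK mulrCA mulr_gt0//; exact: IH.
have a0 := IH i s0 ils.
have e2 : (-1) ^+ ((size s).+1 + i.+1) = (-1) ^+ (size s + i) :> C.
  by rewrite addSn addnS !exprS !mulN1r opprK.
have b0 : 0 <= (-1) ^+ (size s + i.+1) * (\prod_(j <- s) ('X - j%:P))`_i.+1.
  move: ils; rewrite ltnS leq_eqVlt => /predU1P[->|ils]; last exact/ltW/IH.
  by rewrite nth_default ?mulr0// size_prod_XsubC.
rewrite {1}e2 e1 mulNr opprK mulrCA; apply: ltr_wpDr => //.
by rewrite mulr_ge0// ltW.
Qed.

(** Positive roots make the coefficients alternate strictly. Conversely, with alternating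
    coefficients, (-1)^n chi(y) for y <= 0 is a sum of terms ((-1)^(n + j) c_j) (- y)^j >= 0 with
    positive constant term, so no eigenvalue is <= 0. The criterion turns positive definiteness into
    finitely many polynomial inequalities in the entries. *)
Lemma posdef_char_polyP n (A : 'M[C]_n) : A^t* = A ->
  posdef A <-> forall i : 'I_n, 0 < (-1) ^+ (n + i) * (char_poly A)`_i.
Proof.
move=> hA; split=> [pA i|hc].
  have [s [ss _ -> sE]] := det_seq_eigenvalue A.
  rewrite -[X in (X + _)%N]ss; apply: coef_prod_XsubC_sign.
    by move=> z; rewrite sE; exact: posdef_eigenvalue_gt0.
  by rewrite ss ltnW.
have [P [d [PP PP' AE dR dA]]] := hermitian_spectral hA.
have d0 i : 0 < d 0 i.
  rewrite real_ltNge ?real0//; apply/negP => di.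
  have := dA i; rewrite eigenvalue_root_char => /eqP.
  rewrite horner_coef size_char_poly => /(congr1 ( *%R ((-1) ^+ n))).
  rewrite mulr0 mulr_sumr => /eqP; apply/negP; rewrite gt_eqF//.
  have cE j : (-1) ^+ n * ((char_poly A)`_j * d 0 i ^+ j) =
      ((-1) ^+ (n + j) * (char_poly A)`_j) * (- d 0 i) ^+ j :> C.
    have aa : (-1) ^+ j * (-1) ^+ j = 1 :> C by rewrite -expr2 sqrr_sign.
    rewrite exprD (exprNn (d 0 i)) -!mulrA; congr (_ * _).
    by rewrite [X in _ = _ * X]mulrCA [RHS]mulrA aa mul1r.
  (* The index i witnesses n > 0, so the constant coefficient is among those controlled by [hc]; the
     leading one is 1. *)
  have n0 : (0 < n)%N by apply: leq_ltn_trans (ltn_ord i).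
  rewrite big_ord_recr/= cE addnn -muln2 exprM sqrr_sign mul1r.
  have -> : (char_poly A)`_n = 1.
    by have := monicP (char_poly_monic A); rewrite lead_coefE size_char_poly.
  rewrite mul1r ltr_wpDr ?exprn_ge0 ?oppr_ge0//.
  rewrite (bigD1 (Ordinal n0))//= cE expr0 mulr1 ltr_wpDr ?(hc (Ordinal n0))//.
  by apply: sumr_ge0 => j _; rewrite cE mulr_ge0 ?exprn_ge0 ?oppr_ge0// ltW// hc.
apply/posdefP; split=> // v v0.
rewrite AE -[P in _ *m P]trmxCK qform_congr qform_diag.
have /qform1_gt0 : v *m P^t* != 0.
  apply: contra v0 => /eqP/(congr1 (fun M => M *m P)).
  by rewrite -mulmxA PP' mulmx1 mul0mx => ->.
rewrite qform1E => w0.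
rewrite lt_def sumr_ge0 ?andbT; last first.
  by move=> i _; rewrite mulr_ge0 ?exprn_ge0// ltW.
apply: contraTneq w0 => /eqP; rewrite psumr_eq0; last first.
  by move=> i _; rewrite mulr_ge0 ?exprn_ge0// ltW.
move=> /allP w0; rewrite big1 ?ltxx// => i _; apply/eqP.
have := w0 i (mem_index_enum i).
by rewrite mulf_eq0 gt_eqF//=.
Qed.

End PosdefChar.

Section Measurability.
Local Open Scope classical_set_scope.
Local Open Scope sesquilinear_scope.
Variable R : realType.
Local Notation C := R[i].

(** Stated for an arbitrary commutative ring and an arbitrary closed class M because it is used
    twice: for complex-valued functions, and for polynomial-valued ones, the characteristic
    polynomial being a determinant over {poly C}. *)
Lemma det_closed (T : Type) (S : comNzRingType) (M : (T -> S) -> Prop) n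
    (A : T -> 'M[S]_n) :
  (forall c, M (fun=> c)) -> (forall f g, M f -> M g -> M (fun t => f t + g t)) ->
  (forall f g, M f -> M g -> M (fun t => f t * g t)) ->
  (forall i j, M (fun t => A t i j)) -> M (fun t => \det (A t)).
Proof.
move=> MC MD MM MA; rewrite /determinant.
have Msum I r (F : I -> T -> S) : (forall i, M (F i)) ->
    M (fun t => \sum_(i <- r) F i t).
  move=> MF; elim: r => [|i r IH].
    by rewrite (_ : (fun _ => _) = fun=> 0)//; apply/funext => t; rewrite big_nil.
  rewrite (_ : (fun _ => _) = fun t => F i t + \sum_(i <- r) F i t).
    exact: MD.
  by apply/funext => t; rewrite big_cons.
have Mprod I r (F : I -> T -> S) : (forall i, M (F i)) ->
    M (fun t => \prod_(i <- r) F i t).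
  move=> MF; elim: r => [|i r IH].
    by rewrite (_ : (fun _ => _) = fun=> 1)//; apply/funext => t; rewrite big_nil.
  rewrite (_ : (fun _ => _) = fun t => F i t * \prod_(i <- r) F i t).
    exact: MM.
  by apply/funext => t; rewrite big_cons.
by apply: Msum => s; apply: MM => //; exact: Mprod.
Qed.

Section Complex.
Context d (T : measurableType d).

Definition cmeasurable (f : T -> C) :=
  measurable_fun [set: T] (fun t => complex.Re (f t)) /\
  measurable_fun [set: T] (fun t => complex.Im (f t)).

Lemma cmeasurable_cst c : cmeasurable (fun=> c).
Proof. by split; exact: measurable_cst. Qed.

Lemma cmeasurableD f g : cmeasurable f -> cmeasurable g ->
  cmeasurable (fun t => f t + g t).
Proof.
move=> [f1 f2] [g1 g2]; split.
  rewrite (_ : (fun _ => _) = fun t => complex.Re (f t) + complex.Re (g t)).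
    exact: measurable_funD.
  by apply/funext => t; case: (f t) (g t) => [? ?] [].
rewrite (_ : (fun _ => _) = fun t => complex.Im (f t) + complex.Im (g t)).
  exact: measurable_funD.
by apply/funext => t; case: (f t) (g t) => [? ?] [].
Qed.

Lemma cmeasurableM f g : cmeasurable f -> cmeasurable g ->
  cmeasurable (fun t => f t * g t).
Proof.
move=> [f1 f2] [g1 g2]; split.
  rewrite (_ : (fun _ => _) = fun t => complex.Re (f t) * complex.Re (g t) -
      complex.Im (f t) * complex.Im (g t)).
    by apply: measurable_funB; exact: measurable_funM.
  by apply/funext => t; case: (f t) (g t) => [? ?] [].
rewrite (_ : (fun _ => _) = fun t => complex.Re (f t) * complex.Im (g t) +
    complex.Im (f t) * complex.Re (g t)).
  by apply: measurable_funD; exact: measurable_funM.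
by apply/funext => t; case: (f t) (g t) => [? ?] [].
Qed.

Lemma cmeasurable_det n (A : T -> 'M[C]_n) :
  (forall i j, cmeasurable (fun t => A t i j)) ->
  cmeasurable (fun t => \det (A t)).
Proof.
move=> mA; apply: (det_closed cmeasurable_cst cmeasurableD cmeasurableM) => //.
Qed.

Lemma cmeasurable_sum I r (F : I -> T -> C) : (forall i, cmeasurable (F i)) ->
  cmeasurable (fun t => \sum_(i <- r) F i t).
Proof.
move=> mF; elim: r => [|i r IH].
  rewrite (_ : (fun _ => _) = fun=> 0); first exact: cmeasurable_cst.
  by apply/funext => t; rewrite big_nil.
rewrite (_ : (fun _ => _) = fun t => F i t + \sum_(i <- r) F i t).
  exact: cmeasurableD.
by apply/funext => t; rewrite big_cons.
Qed.

Lemma cmeasurable_coef_char_poly n (A : T -> 'M[C]_n) k :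
  (forall i j, cmeasurable (fun t => A t i j)) ->
  cmeasurable (fun t => (char_poly (A t))`_k).
Proof.
move=> mA; rewrite /char_poly; move: k.
(* Coefficientwise measurability is stable under products, since the coefficients of a product are
   finite convolutions. *)
pose M (p : T -> {poly C}) := forall k, cmeasurable (fun t => (p t)`_k).
apply: (@det_closed T {poly C} M).
- by move=> c k; exact: cmeasurable_cst.
- move=> f g mf mg k.
  rewrite (_ : (fun _ => _) = fun t => (f t)`_k + (g t)`_k).
    exact: cmeasurableD.
  by apply/funext => t; rewrite coefD.
- move=> f g mf mg k.
  rewrite (_ : (fun _ => _) = fun t => \sum_(j < k.+1) (f t)`_j * (g t)`_(k - j)).
    by apply: cmeasurable_sum => j; exact: cmeasurableM.
  by apply/funext => t; rewrite coefM.
move=> i j k.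
rewrite (_ : (fun _ => _) = fun t => (('X%:M : 'M[{poly C}]_n) i j)`_k +
    (-1) * (if k == 0%N then A t i j else 0)).
  apply: cmeasurableD; first exact: cmeasurable_cst.
  apply: cmeasurableM; first exact: cmeasurable_cst.
  by case: eqP => _; [exact: mA | exact: cmeasurable_cst].
apply/funext => t; rewrite /char_poly_mx !mxE coefB coefC.
by rewrite mulN1r.
Qed.

Lemma measurable_complex_gt0 (f : T -> C) : cmeasurable f ->
  measurable [set t | 0 < f t].
Proof.
move=> [f1 f2].
(* In the partial order of R[i], positivity includes being real. *)
rewrite (_ : [set t | 0 < f t] =
  [set t | complex.Im (f t) == 0] `&` [set t | 0 < complex.Re (f t)]).
  apply: measurableI.
    rewrite -[X in measurable X]setTI.
    by apply: measurable_fun_eqr => //; exact: measurable_cst.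
  rewrite -[X in measurable X]setTI.
  by apply: measurable_fun_ltr => //; exact: measurable_cst.
by apply/seteqP; split=> t /=; rewrite ltcE /= => /andP.
Qed.

Lemma measurable_posdef n (A : T -> 'M[C]_n) :
  (forall t, (A t)^t* = A t) -> (forall i j, cmeasurable (fun t => A t i j)) ->
  measurable [set t | posdef (A t)].
Proof.
move=> hA mA.
rewrite (_ : [set t | posdef (A t)] = \bigcap_(i in [set: 'I_n])
    [set t | 0 < (-1) ^+ (n + i) * (char_poly (A t))`_i]).
  apply: fin_bigcap_measurable => // i _; apply: measurable_complex_gt0.
  by apply: cmeasurableM; [exact: cmeasurable_cst | exact: cmeasurable_coef_char_poly].
apply/seteqP; split=> t /=.
  by move=> /(posdef_char_polyP (hA t)) h i _; exact: h.
by move=> h; apply/(posdef_char_polyP (hA t)) => i; exact: h.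
Qed.

End Complex.

Lemma herm_of_trmxC r (t : (r * r).-tuple R) : (herm_of t)^t* = herm_of t.
Proof.
apply/matrixP => i j; rewrite !mxE -!val_eqE /=.
case: ltngtP => [ij|ij|/ord_inj ij]; last by rewrite ij; exact: conjc_real.
  by apply/eqP; rewrite eq_complex /= !eqxx.
by apply/eqP; rewrite eq_complex /= opprK !eqxx.
Qed.

Lemma cmeasurable_herm_of r (i j : 'I_r) :
  cmeasurable (fun t : (r * r).-tuple R => herm_of t i j).
Proof.
have mt k : measurable_fun [set: (r * r).-tuple R] (fun t => tnth t k).
  exact: measurable_tnth.
split.
  rewrite (_ : (fun _ => _) = fun t : (r * r).-tuple R =>
    if (i < j)%N then tnth t (mxvec_index i j) else tnth t (mxvec_index j i)).
    by case: (i < j)%N.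
  apply/funext => t; rewrite mxE; case: eqVneq => [->|_]; first by rewrite ltnn.
  by case: ifP.
rewrite (_ : (fun _ => _) = fun t : (r * r).-tuple R => if i == j then 0 else
  if (i < j)%N then tnth t (mxvec_index j i) else - tnth t (mxvec_index i j)).
  case: (i == j); first exact: measurable_cst.
  by case: (i < j)%N => //; exact: measurable_funN.
by apply/funext => t; rewrite mxE; case: eqVneq => [->|_]//; case: ifP.
Qed.

Lemma measurable_unit_box r : measurable (@herm_of R r @^-1` unit_box R r).
Proof.
rewrite (_ : _ @^-1` _ = [set t | posdef (herm_of t)] `&`
    [set t : (r * r).-tuple R | posdef (1%:M - herm_of t)]); last by [].
apply: measurableI; apply: measurable_posdef.
- by move=> t; exact: herm_of_trmxC.
- exact: cmeasurable_herm_of.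
- by move=> t; rewrite trmxCD trmxCN trmxC1 herm_of_trmxC.
- move=> i j; rewrite (_ : (fun _ => _) =
      fun t : (r * r).-tuple R => (1%:M : 'M[C]_r) i j + (-1) * herm_of t i j).
    apply: cmeasurableD; first exact: cmeasurable_cst.
    by apply: cmeasurableM; [exact: cmeasurable_cst | exact: cmeasurable_herm_of].
  by apply/funext => t; rewrite !mxE mulN1r.
Qed.

End Measurability.

(** * Convergence of the Euler integral *)

Section Ellipsoid.
Local Open Scope classical_set_scope.
Local Open Scope sesquilinear_scope.
Variable R : realType.
Local Notation lambda := (@lebesgue_measure R).
Local Notation C := R[i].

Lemma tnth_upd N (t : N.-tuple R) i s j :
  tnth (upd t i s) j = if j == i then s else tnth t j.
Proof. by rewrite tnth_mktuple. Qed.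

Lemma integral_quadraticZ_le (k : R) : -1 < k -> exists2 K : R, 0 <= K &
  forall c d L y, 0 <= c -> 0 < d ->
    (\int[lambda]_s (c * ppow k (L - d * (s - y) ^+ 2))%:E <=
      (c * K * d `^ (- 2^-1) * ppow (k + 2^-1) L)%:E)%E.
Proof.
move=> /integral_quadratic_le[K K0 HK]; exists K => // c d L y c0 d0.
under eq_integral do rewrite EFinM.
rewrite ge0_integralZl_EFin//.
- rewrite -!mulrA EFinM lee_wpmul2l ?lee_fin// mulrA.
  exact: HK.
- by move=> s _; rewrite lee_fin ppow_ge0.
- apply/measurable_EFinP; apply: (measurableT_comp (measurable_ppow k)).
  apply: measurable_funB; first exact: measurable_cst.
  apply: measurable_funM; first exact: measurable_cst.
  apply: measurable_funX; apply: measurable_funB => //; exact: measurable_cst.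
Qed.

Variables (N n : nat) (re im : 'I_n -> 'I_N).
Hypotheses (re_inj : injective re) (im_inj : injective im)
  (re_im : forall i j, re i != im j).

Let im_re i j : im i != re j. Proof. by rewrite eq_sym re_im. Qed.

Section Form.
Variables (P : 'M[C]_n) (delta : 'I_n -> R).
Hypothesis delta_gt0 : forall i, 0 < delta i.

Definition coordC (t : N.-tuple R) (i : 'I_n) : C :=
  Complex (tnth t (re i)) (tnth t (im i)).

Definition tailC (t : N.-tuple R) (i : 'I_n) : C :=
  \sum_(m < n | (i < m)%N) coordC t m * P m i.

(** The squares of index at least k in v H v^* = sum_i delta_i |(v P)_i|^2. Since [tailC t i]
    involves only v_m with m > i, [tail_form j.+1] is independent of v_j, so the v_j can be
    eliminated in increasing order. *)
Definition tail_form (k : nat) (t : N.-tuple R) : R :=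
  \sum_(i < n | (k <= i)%N) delta i *
    ((tnth t (re i) + complex.Re (tailC t i)) ^+ 2 +
     (tnth t (im i) + complex.Im (tailC t i)) ^+ 2).

Lemma tailC_upd t (i j : 'I_n) s : (j <= i)%N ->
  tailC (upd t (re j) s) i = tailC t i /\ tailC (upd t (im j) s) i = tailC t i.
Proof.
move=> ji; split; apply: eq_bigr => m im_; congr (_ * _);
  rewrite /coordC !tnth_upd ?(inj_eq re_inj) ?(inj_eq im_inj)
    ?(negbTE (re_im _ _)) ?(negbTE (im_re _ _)) (_ : m == j = false)//;
  by apply/negbTE; rewrite -val_eqE /= gtn_eqF// (leq_ltn_trans ji).
Qed.

Lemma tail_form_upd t (j : 'I_n) s :
  tail_form j.+1 (upd t (re j) s) = tail_form j.+1 t /\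
  tail_form j.+1 (upd t (im j) s) = tail_form j.+1 t.
Proof.
split; apply: eq_bigr => i ji; have [t1 t2] := tailC_upd t s (ltnW ji);
  rewrite ?t1 ?t2 !tnth_upd ?(inj_eq re_inj) ?(inj_eq im_inj)
    ?(negbTE (re_im _ _)) ?(negbTE (im_re _ _)) (_ : i == j = false)//;
  by apply/negbTE; rewrite -val_eqE /= gtn_eqF.
Qed.

Lemma tail_formS t (j : 'I_n) :
  tail_form j t = delta j * ((tnth t (re j) + complex.Re (tailC t j)) ^+ 2 +
     (tnth t (im j) + complex.Im (tailC t j)) ^+ 2) + tail_form j.+1 t.
Proof.
rewrite /tail_form (bigD1 j)//=; congr (_ + _); apply: eq_bigl => i.
by rewrite ltn_neqAle andbC eq_sym val_eqE.
Qed.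

(** Integrating Re v_j and then Im v_j raises the exponent by 1/2 each time and yields a factor
    delta_j^(-1/2) each time. The one-variable bounds are taken as hypotheses so that K1 and K2 can
    be fixed from the exponents before P and delta are known. The set S, stable under the updates,
    records the coordinates kept frozen. *)
Lemma integ_tail_form_le (kappa : R) (j : 'I_n) (S : set (N.-tuple R)) K1 K2 :
  (forall t s, S t -> S (upd t (re j) s) /\ S (upd t (im j) s)) ->
  0 <= K1 ->
  (forall c d L y, 0 <= c -> 0 < d ->
    (\int[lambda]_s (c * ppow kappa (L - d * (s - y) ^+ 2))%:E <=
      (c * K1 * d `^ (- 2^-1) * ppow (kappa + 2^-1) L)%:E)%E) ->
  (forall c d L y, 0 <= c -> 0 < d ->
    (\int[lambda]_s (c * ppow (kappa + 2^-1) (L - d * (s - y) ^+ 2))%:E <=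
      (c * K2 * d `^ (- 2^-1) * ppow (kappa + 2^-1 + 2^-1) L)%:E)%E) ->
  forall f c, 0 <= c -> (forall t, 0 <= f t)%E ->
  (forall t, S t -> (f t <= (c * ppow kappa (1 - tail_form j t))%:E)%E) ->
  forall t, S t -> (integ (im j) (integ (re j) f) t <=
    (c * K1 * K2 * (delta j)^-1 * ppow (kappa + 1) (1 - tail_form j.+1 t))%:E)%E.
Proof.
move=> SU K10 HK1 HK2 f c c0 f0 fS t St.
have dj := delta_gt0 j.
pose x t := complex.Re (tailC t j); pose y t := complex.Im (tailC t j).
have step1 u : S u -> (integ (re j) f u <= (c * K1 * delta j `^ (- 2^-1) *
    ppow (kappa + 2^-1)
      (1 - tail_form j.+1 u - delta j * (tnth u (im j) + y u) ^+ 2))%:E)%E.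
  move=> Su; apply: le_trans (HK1 c (delta j) _ (- x u) c0 dj).
  apply: ge0_le_integral_nonmeasurable => [s|s]; first exact: f0.
  apply: le_trans (fS _ (SU u s Su).1) _.
  rewrite tail_formS (tail_form_upd u j s).1 (tailC_upd u s (leqnn j)).1.
  rewrite !tnth_upd eqxx eq_sym (negbTE (re_im _ _)) -/(x u) -/(y u).
  rewrite (_ : 1 - (delta j * ((s + x u) ^+ 2 + (tnth u (im j) + y u) ^+ 2) +
     tail_form j.+1 u) = 1 - tail_form j.+1 u - delta j *
     (tnth u (im j) + y u) ^+ 2 - delta j * (s - - x u) ^+ 2)//.
  ring.
set c1 := c * K1 * delta j `^ (- 2^-1) in step1.
have c10 : 0 <= c1 by rewrite !mulr_ge0// powR_ge0.
have -> : c * K1 * K2 * (delta j)^-1 * ppow (kappa + 1) (1 - tail_form j.+1 t) =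
    c1 * K2 * delta j `^ (- 2^-1) * ppow (kappa + 2^-1 + 2^-1) (1 - tail_form j.+1 t).
  have -> : kappa + 2^-1 + 2^-1 = kappa + 1 by field.
  have -> : (delta j)^-1 = delta j `^ (- 2^-1) * delta j `^ (- 2^-1).
    rewrite -powRD ?(gt_eqF dj) ?implybT// -powR_inv1 ?ltW//.
    by congr (_ `^ _); field.
  by rewrite /c1; ring.
apply: le_trans (HK2 c1 (delta j) _ (- y t) c10 dj).
apply: ge0_le_integral_nonmeasurable => [s|s]; first exact: integ_ge0.
apply: le_trans (step1 _ (SU t s St).2) _.
rewrite (tail_form_upd t j s).2 /y (tailC_upd t s (leqnn j)).2 -/(y t).
by rewrite tnth_upd eqxx opprK.
Qed.

End Form.

Definition reim_coords (s : seq 'I_n) : seq 'I_N :=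
  flatten [seq [:: re j; im j] | j <- s].

(** The order of quantifiers matters: K depends only on [kappa] and m and serves every P, delta and
    S, because in the application these come from the varying corner U'. *)
Lemma foldl_integ_tail_form_le (kappa : R) (m : nat) : -1 < kappa -> (m <= n)%N ->
  exists2 K : R, 0 <= K &
  forall (P : 'M[C]_n) (delta : 'I_n -> R) (S : set (N.-tuple R)) f c,
  (forall i, 0 < delta i) ->
  (forall t s j, S t -> S (upd t (re j) s) /\ S (upd t (im j) s)) ->
  0 <= c -> (forall t, 0 <= f t)%E ->
  (forall t, S t -> (f t <= (c * ppow kappa (1 - tail_form P delta 0 t))%:E)%E) ->
  forall t, S t ->
   (foldl (fun g i => integ i g) f (reim_coords (take m (enum 'I_n))) t <=
    (c * K * (\prod_(i < n | (i < m)%N) delta i)^-1 *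
      ppow (kappa + m%:R) (1 - tail_form P delta m t))%:E)%E.
Proof.
move=> k1; elim: m => [|m IH] mn.
  exists 1 => // P delta S f c d0 SU c0 f0 fS t St.
  by rewrite take0 /= big_pred0// invr1 !mulr1 addr0 fS.
have [K K0 HK] := IH (ltnW mn).
have km : -1 < kappa + m%:R by rewrite ltr_wpDr.
have km2 : -1 < kappa + m%:R + 2^-1 by rewrite ltr_wpDr.
have [K1 K10 HK1] := integral_quadraticZ_le km.
have [K2 K20 HK2] := integral_quadraticZ_le km2.
exists (K * K1 * K2); first by rewrite !mulr_ge0.
move=> P delta S f c d0 SU c0 f0 fS t St.
pose j := Ordinal mn.
rewrite (take_nth j) ?size_enum_ord// (nth_ord_enum j j) -cats1.
rewrite /reim_coords map_cat flatten_cat foldl_cat /= -/(reim_coords _).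
set g := foldl _ _ _.
have g0 u : (0 <= g u)%E.
  rewrite {}/g; elim: (reim_coords _) f f0 {fS} => //= i s IHs f f0.
  by apply: IHs; exact: integ_ge0.
pose pi k := \prod_(i < n | (i < k)%N) delta i.
have pi0 k : 0 < pi k by apply: prodr_gt0 => i _; exact: d0.
have piS : pi m.+1 = delta j * pi m.
  rewrite /pi (bigD1 j)//=; congr (_ * _); apply: eq_bigl => i.
  by rewrite ltnS leq_eqVlt -val_eqE /=; case: ltngtP.
have c10 : 0 <= c * K * (pi m)^-1 by rewrite !mulr_ge0// invr_ge0 ltW.
have := @integ_tail_form_le P delta d0 (kappa + m%:R) j S K1 K2
  (fun t s => SU t s j) K10 (fun c d L y => HK1 c d L y) (fun c d L y => HK2 c d L y)
  g (c * K * (pi m)^-1) c10 g0 (HK P delta S f c d0 SU c0 f0 fS) t St.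
have -> : c * K * (pi m)^-1 * K1 * K2 * (delta j)^-1 =
    c * (K * K1 * K2) * (pi m.+1)^-1.
  by rewrite piS invfM; ring.
by rewrite -addrA natr1.
Qed.

End Ellipsoid.

(** * Integrating out the first row over the unit box *)

Section BoxIntegrable.
Local Open Scope classical_set_scope.
Local Open Scope sesquilinear_scope.
Local Open Scope complex_scope.
Variable R : realType.
Local Notation lambda := (@lebesgue_measure R).
Local Notation C := R[i].

Lemma ReK_gt0 (z : C) : 0 < z -> (complex.Re z)%:C = z /\ 0 < complex.Re z.
Proof.
by case: z => x y; rewrite ltcE /= => /andP[/eqP -> x0].
Qed.

Lemma ReK_ge0 (z : C) : 0 <= z -> (complex.Re z)%:C = z /\ 0 <= complex.Re z.
Proof.
by case: z => x y; rewrite lecE /= => /andP[/eqP -> x0].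
Qed.

Lemma normc_ge_Im (z : C) : `|complex.Im z|%:C <= `|z|.
Proof.
have := normc_ge_Re (z * 'i); rewrite ReiNIm normrN normrM.
by rewrite [X in _ * X]normc_def /= expr0n expr1n add0r sqrtr1 mulr1.
Qed.

Lemma integral_betaZ_le (p q : R) : -1 < p -> -1 < q -> exists2 K : R, 0 <= K &
  forall c A B, 0 <= c ->
   (\int[lambda]_s (c * (ppow p (s - A) * ppow q (B - s)))%:E <=
    (c * K * ppow (p + q + 1) (B - A))%:E)%E.
Proof.
move=> p1 q1; have [K K0 HK] := integral_beta_le p1 q1; exists K => // c A B c0.
under eq_integral do rewrite EFinM.
rewrite ge0_integralZl_EFin//.
- by rewrite -!mulrA EFinM lee_wpmul2l ?lee_fin//; exact: HK.
- by move=> s _; rewrite lee_fin mulr_ge0// ppow_ge0.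
- apply/measurable_EFinP; apply: measurable_funM.
    apply: (measurableT_comp (measurable_ppow p)).
    by apply: measurable_funB => //; exact: measurable_cst.
  apply: (measurableT_comp (measurable_ppow q)).
  by apply: measurable_funB => //; exact: measurable_cst.
Qed.

Lemma mxvec_index_eq m n (i k : 'I_m) (j l : 'I_n) :
  (mxvec_index i j == mxvec_index k l) = (i == k) && (j == l).
Proof.
by rewrite /mxvec_index (inj_eq (@cast_ord_inj _ _ _)) (inj_eq enum_rank_inj) xpair_eqE.
Qed.

Lemma det_LDL n (A P : 'M[C]_n) (d : 'rV[C]_n) : A = P *m diag_mx d *m P^t* ->
  (forall i j : 'I_n, (i < j)%N -> P i j = 0) -> (forall i, P i i = 1) ->
  \det A = \prod_i d 0 i.
Proof.
move=> -> P0 P1; have dP : \det P = 1.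
  rewrite det_trig; last exact/is_trig_mxP.
  by rewrite big1.
by rewrite !det_mulmx det_map_mx det_tr dP rmorph1 mul1r mulr1 det_diag.
Qed.

(** U^-1 + (1 - U)^-1 = U^-1 ((1 - U) + U) (1 - U)^-1 = U^-1 (1 - U)^-1. *)
Lemma posdef_invD n (U : 'M[C]_n) : unit_box R n U ->
  posdef (invmx U + invmx (1%:M - U)) /\
  \det (invmx U + invmx (1%:M - U)) = (\det U)^-1 * (\det (1%:M - U))^-1.
Proof.
move=> [pU pU1]; split; first by apply: posdefD; exact: posdef_inv.
have uU := posdef_unit pU; have uU1 := posdef_unit pU1.
rewrite -!det_inv -det_mulmx; congr determinant.
rewrite -[LHS]mulmx1; apply: (canRL (mulmxK uU1)).
rewrite mulmx1 mulmxDl mulVmx// mulmxBr mulmx1 mulVmx//.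
by rewrite subrK.
Qed.

(** The factor a b is 1 / det H. It turns the possibly singular a^p b^q into a^(p + 1) b^(q + 1),
    with positive exponents and bases at most 1. *)
Lemma powR_cofactor_le (p q a b K1 K2 : R) : -1 < p -> -1 < q ->
  0 < a <= 1 -> 0 < b <= 1 -> 0 <= K1 -> 0 <= K2 ->
  a `^ p * b `^ q * K1 * K2 * (a * b) <= K1 * K2.
Proof.
move=> p1 q1 /andP[a0 a1] /andP[b0 b1] K10 K20.
have -> : a `^ p * b `^ q * K1 * K2 * (a * b) =
    (a * a `^ p) * (b * b `^ q) * (K1 * K2) by ring.
have le1 x s : 0 < x <= 1 -> -1 < s -> x * x `^ s <= 1.
  move=> /andP[x0 x1] s1; rewrite -{1}(powRr1 (ltW x0)) -powRD ?(gt_eqF x0) ?implybT//.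
  by rewrite -[leRHS](powRr0 x) ger_powR ?x0//; lra.
rewrite ler_piMl ?mulr_ge0// mulr_ile1 ?le1 ?a0 ?b0//.
  by rewrite mulr_ge0 ?powR_ge0 ?ltW.
by rewrite mulr_ge0 ?powR_ge0 ?ltW.
Qed.

Section Schur.
Variable n : nat.
Local Notation r := (1 + n)%N.
(** In the coordinates of [herm_of], [k0], [re j] and [im j] are the positions of U_00, Re v_j and
    Im v_j: the real part is stored above the diagonal and the imaginary part at the transposed
    place. *)
Local Notation k0 := (mxvec_index (lshift n ord0) (lshift n ord0) : 'I_(r * r)).
Let re (j : 'I_n) : 'I_(r * r) := mxvec_index (lshift n ord0) (rshift 1 j).
Let im (j : 'I_n) : 'I_(r * r) := mxvec_index (rshift 1 j) (lshift n ord0).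

Let re_inj : injective re.
Proof. by move=> i j /eqP; rewrite mxvec_index_eq eqxx eq_rshift => /eqP. Qed.

Let im_inj : injective im.
Proof. by move=> i j /eqP; rewrite mxvec_index_eq eqxx andbT eq_rshift => /eqP. Qed.

Let re_im i j : re i != im j.
Proof. by rewrite mxvec_index_eq eq_lrshift. Qed.

Implicit Types t : (r * r).-tuple R.

Lemma drsubmx_herm_of_upd t j s :
  [/\ drsubmx (herm_of (upd t (re j) s)) = drsubmx (herm_of t),
      drsubmx (herm_of (upd t (im j) s)) = drsubmx (herm_of t) &
      drsubmx (herm_of (upd t k0 s)) = drsubmx (herm_of t)].
Proof.
by split; apply/matrixP => a b; rewrite !mxE /= !tnth_upd !mxvec_index_eq
  ?eq_rlshift ?eq_lrshift ?andbF.
Qed.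

Lemma ursubmx_herm_of t j :
  ursubmx (herm_of t) 0 j = coordC re im t j.
Proof. by rewrite !mxE eq_lrshift. Qed.

Lemma ursubmx_herm_of_upd t s :
  ursubmx (herm_of (upd t k0 s)) = ursubmx (herm_of t).
Proof.
apply/rowP => j; rewrite !ursubmx_herm_of /coordC !tnth_upd !mxvec_index_eq.
by rewrite !eq_rlshift andbF.
Qed.

Lemma herm_of00 t : herm_of t (lshift n ord0) (lshift n ord0) = (tnth t k0)%:C.
Proof. by rewrite !mxE eqxx. Qed.

Lemma qform_tail_form (P : 'M[C]_n) (d : 'rV[C]_n) t :
  (forall i j : 'I_n, (i < j)%N -> P i j = 0) -> (forall i, P i i = 1) ->
  (forall i, 0 < d 0 i) ->
  qform (P *m diag_mx d *m P^t*) (ursubmx (herm_of t)) =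
  (tail_form re im P (fun i => complex.Re (d 0 i)) 0 t)%:C.
Proof.
move=> P0 P1 d0; rewrite qform_congr qform_diag /tail_form rmorph_sum/=.
apply: eq_bigr => i _; have [dE _] := ReK_gt0 (d0 i).
rewrite rmorphM/= dE; congr (_ * _).
(* P is unit lower triangular, so (v P)_i is v_i plus the part over m > i. *)
have -> : (ursubmx (herm_of t) *m P) 0 i = coordC re im t i + tailC re im P t i.
  rewrite mxE (bigD1 i)//= P1 mulr1 ursubmx_herm_of; congr (_ + _).
  rewrite /tailC [RHS]big_mkcond [LHS]big_mkcond; apply: eq_bigr => m _.
  rewrite -val_eqE /= ursubmx_herm_of; case: ltngtP => // mi.
  by rewrite P0 ?mulr0.
by rewrite -add_Re2_Im2; case: (tailC _ _ _ _ _) => a b.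
Qed.

Variables (p q : R).
Hypotheses (p1 : -1 < p) (q1 : -1 < q).

Definition box_weight t : \bar R :=
  (\1_(@herm_of R r @^-1` unit_box R r) t *
    (complex.Re (\det (herm_of t)) `^ p *
     complex.Re (\det (1%:M - herm_of t)) `^ q))%:E.

Lemma box_weight_ge0 t : (0 <= box_weight t)%E.
Proof. by rewrite lee_fin !mulr_ge0 ?powR_ge0// indicE ler0n. Qed.

Lemma measurable_box_weight : measurable_fun [set: _] box_weight.
Proof.
have [m1 _] : cmeasurable (fun t => \det (herm_of t : 'M[C]_r)).
  by apply: cmeasurable_det; exact: cmeasurable_herm_of.
have [m2 _] : cmeasurable (fun t => \det (1%:M - herm_of t : 'M[C]_r)).
  apply: cmeasurable_det => i j.
  rewrite (_ : (fun _ => _) =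
      fun t : (r * r).-tuple R => (1%:M : 'M[C]_r) i j + (-1) * herm_of t i j).
    apply: cmeasurableD; first exact: cmeasurable_cst.
    by apply: cmeasurableM; [exact: cmeasurable_cst | exact: cmeasurable_herm_of].
  by apply/funext => t; rewrite !mxE mulN1r.
apply/measurable_EFinP; apply: measurable_funM.
  by apply: measurable_indic; exact: (@measurable_unit_box R r).
apply: measurable_funM.
  exact: (measurableT_comp (@measurable_powR R p) m1).
exact: (measurableT_comp (@measurable_powR R q) m2).
Qed.

(** On the box both determinants factor through their Schur complements, U_00 - v U'^-1 v^* and 1 -
    U_00 - v (1 - U')^-1 v^* , which are then positive. Off the box the left side is 0, whence an
    inequality rather than an equality. *)
Lemma box_weight_schur_le t (U := drsubmx (herm_of t)) (v := ursubmx (herm_of t)) :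
  unit_box R n U ->
  (box_weight t <= (complex.Re (\det U) `^ p * complex.Re (\det (1%:M - U)) `^ q *
    (ppow p (tnth t k0 - complex.Re (qform (invmx U) v)) *
     ppow q (1 - complex.Re (qform (invmx (1%:M - U)) v) - tnth t k0)))%:E)%E.
Proof.
move=> bU; rewrite lee_fin /box_weight indicE.
have [/set_mem Dt|_] := boolP (t \in _); last first.
  by rewrite mul0r !mulr_ge0 ?powR_ge0 ?ppow_ge0.
rewrite mul1r; have [pU pU1] := bU; have [pt pt1] := Dt.
have [aE a0] := ReK_gt0 (posdef_det_gt0 pU).
have [bE b0] := ReK_gt0 (posdef_det_gt0 pU1).
have [AE _] := ReK_ge0 (posdef_qform_ge0 v (posdef_inv pU)).
have [BE _] := ReK_ge0 (posdef_qform_ge0 v (posdef_inv pU1)).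
have [d1E d10] := ReK_gt0 (posdef_det_gt0 pt).
have [d2E d20] := ReK_gt0 (posdef_det_gt0 pt1).
have drE : drsubmx (1%:M - herm_of t : 'M[C]_r) = 1%:M - U.
  by apply/matrixP => i j; rewrite !mxE eq_rshift.
have urE : ursubmx (1%:M - herm_of t : 'M[C]_r) = - v.
  by apply/matrixP => i j; rewrite !mxE eq_lrshift sub0r.
have qN (A : 'M[C]_n) : qform A (- v) = qform A v.
  by rewrite /qform trmxCN mulNmx mulmxN mulNmx opprK.
have S1 := det_schur (posdef_unit pU) (posdef_trmxC pt).
have S2 := @det_schur R n (1%:M - herm_of t).
rewrite drE urE qN in S2.
have {}S2 := S2 (posdef_unit pU1) (posdef_trmxC pt1).
set a := complex.Re (\det U) in aE a0 *; set b := complex.Re _ in bE b0 *.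
set A := complex.Re (qform (invmx U) v) in AE *.
set B := complex.Re _ in BE *.
set d1 := complex.Re _ in d1E d10 *; set d2 := complex.Re _ in d2E d20 *.
have h00 : (herm_of t : 'M[C]_(1 + n)) 0 0 = (tnth t k0)%:C.
  by rewrite -herm_of00; congr (herm_of t _ _); exact/val_inj.
have sub00 (M : 'M[C]_(1 + n)) : (1%:M - M) 0 0 = 1 - M 0 0.
  by rewrite !mxE eqxx.
have e1 : d1 = (tnth t k0 - A) * a.
  by apply: (@complexI R); rewrite rmorphM rmorphB /= aE AE d1E S1 h00.
have e2 : d2 = (1 - B - tnth t k0) * b.
  apply: (@complexI R); rewrite rmorphM !rmorphB rmorph1 /= bE BE d2E S2.
  by rewrite sub00 h00 addrAC.
have u1 : 0 < tnth t k0 - A by rewrite -(pmulr_lgt0 _ a0) -e1.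
have u2 : 0 < 1 - B - tnth t k0 by rewrite -(pmulr_lgt0 _ b0) -e2.
clearbody d1 d2 a b A B.
rewrite !ppowE// e1 e2 !powRM ?(ltW u1) ?(ltW u2) ?(ltW a0) ?(ltW b0)//.
by rewrite mulrACA [leLHS]mulrC.
Qed.

(** Only U_00 and v are integrated. U_00 comes first, by a beta bound with exponents p and q; the
    power p + q + 1 of its interval length then feeds the quadratic bounds for v. *)
Lemma box_weight_iterated : exists K : R, forall t,
  (foldl (fun g i => integ i g) box_weight
    (k0 :: reim_coords re im (enum 'I_n)) t <= K%:E)%E.
Proof.
have [K1 K10 HK1] := integral_betaZ_le p1 q1.
have pq : -1 < p + q + 1 by rewrite -ltrBlDr ltrD.
have [K2 K20 HK2] := foldl_integ_tail_form_le re_inj im_inj re_im pq (leqnn n).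
rewrite take_oversize ?size_enum_ord// in HK2.
exists (K1 * K2) => t /=.
(* The corner is frozen at its value for t; S collects the tuples sharing it, and none of the
   integrated coordinates touches it. *)
pose U := drsubmx (herm_of t).
pose S := [set t' : (r * r).-tuple R | drsubmx (herm_of t') = U].
have SU t' s j : S t' -> S (upd t' (re j) s) /\ S (upd t' (im j) s).
  move=> St'; have [h1 h2 _] := drsubmx_herm_of_upd t' j s.
  by split; [exact: etrans h1 St' | exact: etrans h2 St'].
have Sk t' s : S t' -> S (upd t' k0 s).
  move=> St'; apply: etrans St'; apply/matrixP => a b.
  by rewrite !mxE /= !tnth_upd !mxvec_index_eq !eq_rlshift.
have f0 t' := integ_ge0 k0 box_weight_ge0 t'.
have [bU|nbU] := pselect (unit_box R n U); last first.
  (* If the corner is outside the box, the weight vanishes on S; the general bound with c = 0, and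
     dummy P = 0 and delta = 1, shows that the iterated integral is at most 0. *)
  apply: (@le_trans _ _ 0%E); last by rewrite lee_fin mulr_ge0.
  apply: (@le_trans _ _ _ _ _ (HK2 0 (fun=> 1) S (integ k0 box_weight) 0
    (fun=> ltr01) SU (lexx _) f0 _ t erefl)); last by rewrite !mul0r.
  move=> t' St'; rewrite mul0r.
  rewrite /integ integral0_eq// => s _.
  rewrite /box_weight indicE memNset ?mul0r//= => bt.
  by apply: nbU; rewrite -(Sk t' s St'); exact: unit_box_drsubmx.
have [pU pU1] := bU.
have [pH dH] := posdef_invD bU.
have [P [d [HE P0 P1 d0]]] := posdef_LDL pH.
pose delta i := complex.Re (d 0 i).
have delta0 i : 0 < delta i by have [] := ReK_gt0 (d0 i).
pose a := complex.Re (\det U); pose b := complex.Re (\det (1%:M - U)).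
have [aE a0] := ReK_gt0 (posdef_det_gt0 pU).
have [bE b0] := ReK_gt0 (posdef_det_gt0 pU1).
rewrite -/a -/b in aE bE a0 b0.
have a1 : a <= 1 by have := unit_box_det_le1 bU; rewrite -aE lecR.
have b1 : b <= 1.
  by have := unit_box_det_le1 (unit_box_sym bU); rewrite -bE lecR.
pose c := a `^ p * b `^ q * K1.
have c0 : 0 <= c by rewrite !mulr_ge0 ?powR_ge0.
have fS t' : S t' -> (integ k0 box_weight t' <=
    (c * ppow (p + q + 1) (1 - tail_form re im P delta 0 t'))%:E)%E.
  move=> St'.
  pose v := ursubmx (herm_of t').
  pose A := complex.Re (qform (invmx U) v).
  pose B := complex.Re (qform (invmx (1%:M - U)) v).
  (* A and 1 - B bound U_00 for given v and U', so the interval length 1 - B - A equals 1 - v H v^*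
     . *)
  have -> : 1 - tail_form re im P delta 0 t' = 1 - B - A.
    have := qform_tail_form t' P0 P1 d0; rewrite -HE qformD -/v.
    move=> /(congr1 (@complex.Re R)) /= <-.
    rewrite /A /B; case: (qform _ _) => ? ?; case: (qform _ _) => ? ? /=; ring.
  apply: le_trans (HK1 (a `^ p * b `^ q) A (1 - B) _); last first.
    by rewrite mulr_ge0 ?powR_ge0.
  apply: ge0_le_integral_nonmeasurable => s; first exact: box_weight_ge0.
  have Ss := Sk t' s St'.
  have := @box_weight_schur_le (upd t' k0 s).
  by rewrite Ss ursubmx_herm_of_upd tnth_upd eqxx; apply.
have := HK2 P delta S _ c delta0 SU c0 f0 fS t erefl.
move=> /le_trans; apply; rewrite lee_fin.
have -> : tail_form re im P delta n t = 0.
  by rewrite /tail_form big1// => i; rewrite leqNgt ltn_ord.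
(* The product of the pivots is det H = 1 / (a b), and its inverse is the compensating factor a
   b. *)
have -> : \prod_(i < n | (i < n)%N) delta i = a^-1 * b^-1.
  apply: (@complexI R); rewrite rmorphM !fmorphV/= aE bE -dH (det_LDL HE P0 P1).
  rewrite rmorph_prod; apply: eq_big => i; first by rewrite ltn_ord.
  by move=> _; have [dE _] := ReK_gt0 (d0 i); exact: dE.
rewrite subr0 ppowE// powR1 mulr1 invfM !invrK /c.
by apply: powR_cofactor_le; rewrite ?a0 ?b0.
Qed.

Lemma cube_unit_box t : unit_box R r (herm_of t) -> cube t = 1.
Proof.
move=> bt; rewrite /cube big1// => k _; rewrite indicE mem_set//= in_itv/= -ler_norml.
have ReIm (z : C) : `|z| <= 1 -> `|complex.Re z| <= 1 /\ `|complex.Im z| <= 1.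
  move=> z1; split; rewrite -(@lecR R) (le_trans _ z1)//; first exact: normc_ge_Re.
  exact: normc_ge_Im.
case/mxvec_indexP: k => i j; case: (ltngtP i j) => [ij|ji|/ord_inj ij].
- have [h _] := ReIm _ (unit_box_entry bt i j).
  by move: h; rewrite mxE -val_eqE /= ij ltn_eqF.
- have [_ h] := ReIm _ (unit_box_entry bt j i).
  by move: h; rewrite mxE -val_eqE /= ji ltn_eqF.
- have [h _] := ReIm _ (unit_box_entry bt i j).
  by move: h; rewrite mxE ij eqxx.
Qed.

Lemma integral_box_weight :
  (\int[tuple_lebesgue R (r * r)]_t box_weight t < +oo)%E.
Proof.
have [K HK] := box_weight_iterated.
have := integral_cube_lt_pinfty measurable_box_weight box_weight_ge0 HK.
apply: le_lt_trans; rewrite le_eqVlt; apply/orP; left; apply/eqP.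
apply: eq_integral => t _; have [bt|nbt] := pselect (unit_box R r (herm_of t)).
  by rewrite cube_unit_box// mul1e.
by rewrite /box_weight indicE memNset ?mul0r ?mule0.
Qed.

End Schur.
End BoxIntegrable.

(** * Pfaff transformation *)

Section Power.
Local Open Scope classical_set_scope.
Local Open Scope sesquilinear_scope.
Local Open Scope complex_scope.
Variable R : realType.
Local Notation C := R[i].
Implicit Types (d e : R) (s : C).

(** The principal power for a positive real base, where the argument vanishes: multiplicativity,
    modulus and measurability then reduce to facts about [ln], [expR], [cos] and [sin]. *)
Definition cpowr d s : C := cexp (s * (ln d)%:C).

Lemma cpow_real d s : 0 < d -> cpow d%:C s = cpowr d s.
Proof.
move=> d0; rewrite /cpow /cpowr /clog /carg /cabs /=.
by rewrite expr0n addr0 sqrtr_sqr gtr0_norm// divff ?gt_eqF// acos1 lexx.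
Qed.

Lemma cexpD (z w : C) : cexp (z + w) = cexp z * cexp w.
Proof.
case: z w => [a b] [a' b']; rewrite /cexp /= expRD cosD sinD.
by apply/eqP; rewrite eq_complex /=; apply/andP; split; apply/eqP; ring.
Qed.

Lemma cpowrM d e s : 0 < d -> 0 < e -> cpowr (d * e) s = cpowr d s * cpowr e s.
Proof. by move=> d0 e0; rewrite /cpowr lnM ?posrE// rmorphD mulrDr cexpD. Qed.

Lemma norm_cpowr d s : 0 < d -> `|cpowr d s| = (d `^ complex.Re s)%:C.
Proof.
move=> d0; rewrite /cpowr /cexp normc_def /= !exprMn -mulrDr cos2Dsin2 mulr1.
rewrite sqrtr_sqr ger0_norm ?expR_ge0// /powR gt_eqF//; congr (expR _)%:C.
by case: s => a b /=; ring.
Qed.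

Lemma norm_cpowr3 d1 d2 d3 s1 s2 s3 : 0 < d1 -> 0 < d2 -> 0 < d3 ->
  `|cpowr d1 s1 * cpowr d2 s2 * cpowr d3 s3| = (d1 `^ complex.Re s1 *
    d2 `^ complex.Re s2 * d3 `^ complex.Re s3)%:C.
Proof. by move=> h1 h2 h3; rewrite !normrM !norm_cpowr// !rmorphM. Qed.

Lemma cmeasurable_cpowr dd (T : measurableType dd) (h : T -> R) s :
  measurable_fun [set: T] h -> cmeasurable (fun t => cpowr (h t) s).
Proof.
move=> mh; have ml : measurable_fun [set: T] (fun t => ln (h t)).
  exact: (measurableT_comp (@measurable_ln R)).
have mk k : measurable_fun [set: T] (fun t => k * ln (h t)).
  by apply: measurable_funM => //; exact: measurable_cst.
have mcos : measurable_fun [set: R] (@cos R).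
  by apply: continuous_measurable_fun; exact: continuous_cos.
have msin : measurable_fun [set: R] (@sin R).
  by apply: continuous_measurable_fun; exact: continuous_sin.
have mexp k : measurable_fun [set: T] (fun t => expR (k * ln (h t))).
  exact: (measurableT_comp (@measurable_expR R)).
have E t : cpowr (h t) s =
    Complex (expR (complex.Re s * ln (h t)) * cos (complex.Im s * ln (h t)))
      (expR (complex.Re s * ln (h t)) * sin (complex.Im s * ln (h t))).
  by rewrite /cpowr /cexp; case: s => a b /=; rewrite !mulr0 subr0 add0r.
split.
- rewrite (_ : (fun _ => _) = fun t =>
    expR (complex.Re s * ln (h t)) * cos (complex.Im s * ln (h t))).
    by apply: measurable_funM => //; exact: (measurableT_comp mcos).
  by apply/funext => t; rewrite E.
- rewrite (_ : (fun _ => _) = fun t =>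
    expR (complex.Re s * ln (h t)) * sin (complex.Im s * ln (h t))).
    by apply: measurable_funM => //; exact: (measurableT_comp msin).
  by apply/funext => t; rewrite E.
Qed.

(** The power is monotone, in a direction given by the sign of g; the sum of the two end values
    dominates it either way. *)
Lemma powR_le_between (m M x : R) (g : R) : 0 < m -> m <= x <= M ->
  x `^ g <= m `^ g + M `^ g.
Proof.
move=> m0 /andP[mx xM]; have x0 := lt_le_trans m0 mx.
have [g0|/ltW g0] := leP 0 g.
  rewrite (@le_trans _ _ (M `^ g))// ?lerDr ?powR_ge0//.
  by apply: ge0_ler_powR; rewrite ?nnegrE ?(ltW x0)// (le_trans (ltW x0)).
rewrite (@le_trans _ _ (m `^ g))// ?lerDl ?powR_ge0//.
rewrite -[g]opprK !(powRN _ (- g)) lef_pV2 ?posrE ?powR_gt0//.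
by apply: ge0_ler_powR; rewrite ?nnegrE ?oppr_ge0 ?(ltW x0) ?(ltW m0).
Qed.

End Power.

(** * Integrability of the Euler integrand and operations on Hermitian integrals *)

Section Integrand.
Local Open Scope classical_set_scope.
Local Open Scope sesquilinear_scope.
Local Open Scope complex_scope.
Variable R : realType.
Local Notation C := R[i].

Definition euler_integrand r (alpha beta gamma : C) (x U : 'M[C]_r) : C :=
  cpow (\det U) alpha * cpow (\det (1%:M - U)) beta *
  cpow (\det (1%:M - U *m x)) gamma.

(** The lower bound is e^r, with e a coercivity constant of 1 - x; the upper one is the Leibniz
    expansion with entries of modulus at most B. Together they make the third power bounded on the
    box for every exponent. *)
Lemma unit_box_det_bounds r (x : 'M[C]_r) : x^t* = x -> posdef (1%:M - x) ->
  exists m M : R, 0 < m /\ forall U, unit_box R r U ->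
    m%:C <= \det (1%:M - U *m x) <= M%:C.
Proof.
move=> hx px; have [e e01 ex] := posdef_coercive px.
have /andP[e0 _] := e01; have [eE em] := ReK_gt0 e0.
pose B : R := 1 + \sum_i \sum_j complex.Re `|x i j|.
exists (complex.Re e ^+ r), (r`!%:R * B ^+ r); split; first exact: exprn_gt0.
move=> U bU; have ge := unit_box_det_ge bU hx e01 ex.
rewrite rmorphXn/= eE ge/=.
have d0 : 0 <= \det (1%:M - U *m x) by rewrite (le_trans _ ge)// exprn_ge0 ?ltW.
rewrite -(ger0_norm d0) rmorphM rmorphXn rmorph_nat/=.
apply: det_norm_le => i j; rewrite !mxE.
apply: le_trans (ler_normB _ _) _.
rewrite /B rmorphD rmorph1 lerD//.
  by case: (i == j); rewrite ?normr1 ?normr0.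
rewrite rmorph_sum/= (le_trans (ler_norm_sum _ _ _))//; apply: ler_sum => k _.
have xE k' : (complex.Re `|x k k'|)%:C = `|x k k'|.
  by have [->] := ReK_ge0 (normr_ge0 (x k k')).
rewrite normrM rmorph_sum/= (bigD1 j)//= xE ler_wpDr//.
  by apply: sumr_ge0 => l _; rewrite xE.
by rewrite ler_piMl// unit_box_entry.
Qed.

Lemma unit_box_detE r (x U : 'M[C]_r) : x^t* = x -> posdef (1%:M - x) ->
  unit_box R r U ->
  (complex.Re (\det (1%:M - U *m x)))%:C = \det (1%:M - U *m x) /\
  0 < complex.Re (\det (1%:M - U *m x)).
Proof.
move=> hx px bU; have [m [M [m0 HmM]]] := unit_box_det_bounds hx px.
apply: ReK_gt0; have /andP[+ _] := HmM U bU; apply: lt_le_trans.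
by rewrite ltcR.
Qed.

Lemma herm_integral_reflect r (f : 'M[C]_r -> C) :
  (forall h, h = @complex.Re R \/ h = @complex.Im R ->
    (tuple_lebesgue R (r * r)).-integrable (@herm_of R r @^-1` unit_box R r)
      (fun t => (h (f (herm_of t)))%:E)) ->
  herm_integral (unit_box R r) (fun U => f (1%:M - U)) =
  herm_integral (unit_box R r) f.
Proof.
set D := _ @^-1` _ => fI.
(* Centres given by the entries of the identity matrix: 1 on diagonal coordinates, 0 elsewhere. *)
pose c (k : 'I_(r * r)) : R := mxvec (1%:M : 'M[R]_r) 0 k.
have hE t : herm_of (reflect_tuple c t) = 1%:M - herm_of t :> 'M[C]_r.
  apply/matrixP => i j; rewrite !mxE /= !tnth_mktuple /c !mxvecE !mxE.
  rewrite (eq_sym j); case: eqVneq => [->|ij].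
    by apply/eqP; rewrite eq_complex /= ?subr0 ?oppr0 ?eqxx.
  by case: ifP => _; apply/eqP; rewrite eq_complex /= !sub0r ?opprK ?eqxx.
have DE : reflect_tuple c @^-1` D = D.
  apply/seteqP; split => t; rewrite /D /= hE; last exact: unit_box_sym.
  by move=> /unit_box_sym; rewrite subKr.
have memD t : (reflect_tuple c t \in D) = (t \in D).
  apply/idP/idP => /set_mem h; apply/mem_set; first by rewrite -DE; exact: h.
  have : (reflect_tuple c @^-1` D) t by rewrite DE.
  by [].
have mD : measurable D by exact: (@measurable_unit_box R r).
have E (h : C -> R) : h = @complex.Re R \/ h = @complex.Im R ->
    (\int[tuple_lebesgue R (r * r)]_(t in D) (h (f (1%:M - herm_of t)))%:E =
     \int[tuple_lebesgue R (r * r)]_(t in D) (h (f (herm_of t)))%:E)%E.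
  move=> /fI /integrableP[mh _].
  have mhp : measurable_fun D (fun t => (h (f (herm_of t)))%:E) by [].
  have key (g : (r * r).-tuple R -> \bar R) : measurable_fun D g ->
      (forall t, 0 <= g t)%E ->
      (\int[tuple_lebesgue R (r * r)]_(t in D) g (reflect_tuple c t) =
       \int[tuple_lebesgue R (r * r)]_(t in D) g t)%E.
    move=> mg g0; rewrite integral_mkcond [RHS]integral_mkcond.
    rewrite -(@ge0_integral_reflect_tuple _ _ c (g \_ D)).
    - by apply: eq_integral => t _; rewrite /patch memD.
    - by apply: (proj1 (measurable_restrictT g mD)).
    - by move=> t; exact: erestrict_ge0.
  pose F t := (h (f (herm_of t)))%:E.
  rewrite (_ : (fun t => _) = F \o reflect_tuple c); last first.
    by apply/funext => t; rewrite /= /F hE.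
  rewrite integralE [RHS]integralE funepos_comp funeneg_comp.
  congr (_ - _)%E; apply: key.
  - exact: measurable_funepos.
  - by move=> t; exact: funepos_ge0.
  - exact: measurable_funeneg.
  - by move=> t; exact: funeneg_ge0.
by rewrite /herm_integral /Rintegral -/D !E; [| right | left].
Qed.

(** A complex factor mixes the integrals of the real and imaginary parts, and additivity of those
    signed integrals is what calls for integrability. *)
Lemma herm_integralZ r (k : C) (f : 'M[C]_r -> C) :
  (forall h, h = @complex.Re R \/ h = @complex.Im R ->
    (tuple_lebesgue R (r * r)).-integrable (@herm_of R r @^-1` unit_box R r)
      (fun t => (h (f (herm_of t)))%:E)) ->
  herm_integral (unit_box R r) (fun U => k * f U) =
  k * herm_integral (unit_box R r) f.
Proof.
set D := _ @^-1` _ => fI.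
have mD : measurable D by exact: (@measurable_unit_box R r).
have iR := fI _ (or_introl erefl); have iI := fI _ (or_intror erefl).
have iZ (g : (r * r).-tuple R -> R) a :
    (tuple_lebesgue R (r * r)).-integrable D (EFin \o g) ->
    (tuple_lebesgue R (r * r)).-integrable D (EFin \o (fun t => a * g t)).
  by move=> ig; exact: (integrableZl mD a ig).
rewrite /herm_integral -/D; case: k => a b.
rewrite [RHS](_ : _ = Complex
  (a * (\int[tuple_lebesgue R (r * r)]_(t in D) complex.Re (f (herm_of t))) -
   b * (\int[tuple_lebesgue R (r * r)]_(t in D) complex.Im (f (herm_of t))))
  (a * (\int[tuple_lebesgue R (r * r)]_(t in D) complex.Im (f (herm_of t))) +
   b * (\int[tuple_lebesgue R (r * r)]_(t in D) complex.Re (f (herm_of t)))))//.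
congr Complex.
  rewrite -!RintegralZl// -RintegralB//; last 2 first.
  - exact: iZ.
  - exact: iZ.
  by apply: eq_Rintegral => t _; case: (f _).
rewrite -!RintegralZl// -RintegralD//; last 2 first.
- exact: iZ.
- exact: iZ.
by apply: eq_Rintegral => t _; case: (f _).
Qed.

Lemma eq_herm_integral r (f g : 'M[C]_r -> C) :
  (forall U, unit_box R r U -> f U = g U) ->
  herm_integral (unit_box R r) f = herm_integral (unit_box R r) g.
Proof.
move=> fg; rewrite /herm_integral; congr Complex;
  by apply: eq_Rintegral => t /set_mem Dt; rewrite fg.
Qed.

(** The modulus is at most a constant times [box_weight] with exponents Re alpha and Re beta,
    because the third factor lies between m and M. *)
Lemma euler_integrand_integrable n (alpha beta gamma : C) (x : 'M[C]_(1 + n)) h :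
  x^t* = x -> posdef (1%:M - x) ->
  -1 < complex.Re alpha -> -1 < complex.Re beta ->
  h = @complex.Re R \/ h = @complex.Im R ->
  (tuple_lebesgue R ((1 + n) * (1 + n))).-integrable
    (@herm_of R (1 + n) @^-1` unit_box R (1 + n))
    (fun t => (h (euler_integrand alpha beta gamma x (herm_of t)))%:E).
Proof.
move=> hx px a1 b1 hE; set D := _ @^-1` _.
have mD : measurable D by exact: (@measurable_unit_box R (1 + n)).
have [m [M [m0 HmM]]] := unit_box_det_bounds hx px.
pose K := m `^ complex.Re gamma + M `^ complex.Re gamma.
have K0 : 0 <= K by rewrite addr_ge0 ?powR_ge0.
pose w := @box_weight R n (complex.Re alpha) (complex.Re beta).
have iw : (tuple_lebesgue R ((1 + n) * (1 + n))).-integrable D (fun t => K%:E * w t)%E.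
  apply: integrableZl => //; apply: (@integrableS _ _ _ _ setT D) => //.
  apply/integrableP; split; first exact: measurable_box_weight.
  under eq_integral do rewrite gee0_abs ?box_weight_ge0//.
  exact: integral_box_weight.
pose d1 (t : ((1 + n) * (1 + n)).-tuple R) := complex.Re (\det (herm_of t)).
pose d2 (t : ((1 + n) * (1 + n)).-tuple R) := complex.Re (\det (1%:M - herm_of t)).
pose d3 (t : ((1 + n) * (1 + n)).-tuple R) :=
  complex.Re (\det (1%:M - herm_of t *m x)).
(* G is measurable on the whole coordinate space and agrees on D with the integrand, all three
   determinants being positive there. *)
pose G t : C := cpowr (d1 t) alpha * cpowr (d2 t) beta * cpowr (d3 t) gamma.
have dD t : D t -> [/\ 0 < d1 t, 0 < d2 t, 0 < d3 t &
    euler_integrand alpha beta gamma x (herm_of t) = G t].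
  move=> Dt; have [p1 p2] := Dt.
  have [e1 l1] := ReK_gt0 (posdef_det_gt0 p1).
  have [e2 l2] := ReK_gt0 (posdef_det_gt0 p2).
  have [e3 l3] := unit_box_detE hx px Dt.
  split; [exact: l1 | exact: l2 | exact: l3 |].
  by rewrite /euler_integrand -e1 -e2 -e3 (cpow_real _ l1) (cpow_real _ l2)
    (cpow_real _ l3).
have md (A : 'M[C]_(1 + n)) : measurable_fun [set: ((1 + n) * (1 + n)).-tuple R]
    (fun t => complex.Re (\det (1%:M - herm_of t *m A))).
  have [//] : cmeasurable (fun t : ((1 + n) * (1 + n)).-tuple R =>
    \det (1%:M - herm_of t *m A)).
  apply: cmeasurable_det => i j.
  rewrite (_ : (fun _ => _) = fun t : ((1 + n) * (1 + n)).-tuple R =>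
      (1%:M : 'M[C]_(1 + n)) i j +
      (-1) * \sum_(k <- enum 'I_(1 + n)) herm_of t i k * A k j).
    apply: cmeasurableD; first exact: cmeasurable_cst.
    apply: cmeasurableM; first exact: cmeasurable_cst.
    apply: cmeasurable_sum => k.
    by apply: cmeasurableM; [exact: cmeasurable_herm_of | exact: cmeasurable_cst].
  by apply/funext => t; rewrite !mxE mulN1r big_enum.
have m3 := md x.
have m2 : measurable_fun [set: ((1 + n) * (1 + n)).-tuple R] d2.
  by have := md 1%:M; rewrite /d2; under eq_fun do rewrite mulmx1.
have m1 : measurable_fun [set: ((1 + n) * (1 + n)).-tuple R] d1.
  have [//] : cmeasurable (fun t => \det (herm_of t : 'M[C]_(1 + n))).
  by apply: cmeasurable_det; exact: cmeasurable_herm_of.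
have [mG1 mG2] : cmeasurable G.
  have mg1 := cmeasurable_cpowr alpha m1; have mg2 := cmeasurable_cpowr beta m2.
  exact: (cmeasurableM (cmeasurableM mg1 mg2) (cmeasurable_cpowr gamma m3)).
have mF : measurable_fun D
    (fun t => (h (euler_integrand alpha beta gamma x (herm_of t)))%:E).
  apply: (eq_measurable_fun (fun t => (h (G t))%:E)).
    by move=> t /set_mem /dD[_ _ _ ->].
  apply/measurable_EFinP/measurable_funTS.
  by case: hE => ->.
apply: le_integrable iw => // t Dt; have [l1 l2 l3 ->] := dD t Dt.
have wE : w t = (d1 t `^ complex.Re alpha * d2 t `^ complex.Re beta)%:E.
  by rewrite /w /box_weight indicE mem_set// mul1r.
rewrite wE -EFinM /= lee_fin.
rewrite [leRHS]ger0_norm ?mulr_ge0 ?powR_ge0//.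
apply: (@le_trans _ _ (d1 t `^ complex.Re alpha * d2 t `^ complex.Re beta *
  d3 t `^ complex.Re gamma)); last first.
  rewrite mulrC ler_wpM2r ?mulr_ge0 ?powR_ge0//.
  apply: powR_le_between => //; have [e3 _] := unit_box_detE hx px Dt.
  by have := HmM _ Dt; rewrite -e3 !lecR.
rewrite -(@lecR R); have hle (z : C) : `|h z|%:C <= `|z|.
  by case: hE => ->; [exact: normc_ge_Re | exact: normc_ge_Im].
by apply: le_trans (hle _) _; rewrite /G norm_cpowr3.
Qed.

End Integrand.

Section Pfaff.
Local Open Scope classical_set_scope.
Local Open Scope sesquilinear_scope.
Local Open Scope complex_scope.
Variable R : realType.
Local Notation C := R[i].

(** In this form of y the relation 1 - y = (1 - x)^-1 is visible, so y is Hermitian with 1 - y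
    positive definite, as x was. *)
Lemma pfaff_argE n (x : 'M[C]_n) : posdef (1%:M - x) ->
  x *m invmx (x - 1%:M) = 1%:M - invmx (1%:M - x).
Proof.
move=> /posdef_unit u; have u' : x - 1%:M \in unitmx.
  by rewrite -opprB -scaleN1r unitmxZ ?unitrN1.
apply: (canLR (mulmxK u')).
have -> : (1%:M - invmx (1%:M - x)) *m (x - 1%:M) =
    x - 1%:M + invmx (1%:M - x) *m (1%:M - x).
  by rewrite mulmxBl mul1mx -mulmxN opprB.
by rewrite mulVmx// subrK.
Qed.

(** From y (1 - x) = - x one gets (1 - U y) (1 - x) = 1 - x + U x, an identity already between
    matrices. *)
Lemma det_pfaff n (x U : 'M[C]_n) (y := 1%:M - invmx (1%:M - x)) :
  posdef (1%:M - x) ->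
  \det (1%:M - (1%:M - U) *m x) = \det (1%:M - x) * \det (1%:M - U *m y).
Proof.
move=> /posdef_unit u; rewrite mulrC -det_mulmx; congr determinant.
rewrite mulmxBl [in RHS]mulmxBl !mul1mx -mulmxA /y (mulmxBl 1%:M) mul1mx mulVmx//.
have -> : 1%:M - x - 1%:M = - x by rewrite addrAC subrr sub0r.
by rewrite mulmxN opprK opprB addrA addrAC.
Qed.

Lemma euler_integral_pfaff n (alpha beta gamma : C) (x : 'M[C]_(1 + n)) :
  x^t* = x -> posdef (1%:M - x) ->
  -1 < complex.Re alpha -> -1 < complex.Re beta ->
  herm_integral (unit_box R (1 + n)) (euler_integrand alpha beta gamma x) =
  cpow (\det (1%:M - x)) gamma * herm_integral (unit_box R (1 + n))
    (euler_integrand beta alpha gamma (x *m invmx (x - 1%:M))).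
Proof.
move=> hx px a1 b1; rewrite pfaff_argE//.
have pV := posdef_inv px.
have hy : (1%:M - invmx (1%:M - x))^t* = 1%:M - invmx (1%:M - x).
  by rewrite trmxCD trmxCN trmxC1 (posdef_trmxC pV).
have py : posdef (1%:M - (1%:M - invmx (1%:M - x))) by rewrite subKr.
have dE U := det_pfaff U px.
move: (1%:M - invmx (1%:M - x)) hy py dE => y hy py dE.
transitivity (herm_integral (unit_box R (1 + n))
    (fun U => euler_integrand alpha beta gamma x (1%:M - U))).
  apply/esym/herm_integral_reflect => h hE.
  exact: (euler_integrand_integrable gamma hx px a1 b1 hE).
transitivity (herm_integral (unit_box R (1 + n))
    (fun U => cpow (\det (1%:M - x)) gamma * euler_integrand beta alpha gamma y U));
  last first.
  apply: herm_integralZ => h hE.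
  exact: (euler_integrand_integrable gamma hy py b1 a1 hE).
apply: eq_herm_integral => U bU; rewrite /euler_integrand subKr.
have [e1 l1] := ReK_gt0 (posdef_det_gt0 px).
have [e2 l2] := unit_box_detE hy py bU.
rewrite dE -e1 -e2 -rmorphM !cpow_real ?mulr_gt0// cpowrM//.
by rewrite (mulrC (cpow _ alpha)) mulrCA.
Qed.

Lemma Re_natr (k : nat) : complex.Re (k%:R : C) = k%:R.
Proof. by rewrite -(rmorph_nat (real_complex R)). Qed.

Lemma hypergeo_pfaff r (a b c : C) (x : 'M[C]_r) : (1 <= r)%N ->
  r%:R - 1 < complex.Re a -> r%:R - 1 < complex.Re (c - a) ->
  x \is hermsymmx -> posdef (1%:M - x) ->
  hypergeo a b c x = cpow (\det (1%:M - x)) (- b) *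
    hypergeo (c - a) b c (x *m invmx (x - 1%:M)).
Proof.
case: r x => [//|n] x _ a1 ca1; rewrite hermsymmxE => /eqP hx px.
have Reb (z : C) : n.+1%:R - 1 < complex.Re z -> -1 < complex.Re (z - n.+1%:R).
  rewrite -(Re_natr n.+1); case: z => u v; case: (n.+1%:R : C) => k l /=.
  by rewrite ltrBlDr -ltrBlDl => ?; lra.
(* Under a |-> c - a the two Gamma factors of the denominator are exchanged, and so are the
   exponents of det U and det (1 - U). *)
rewrite /hypergeo [RHS]mulrCA subKr (mulrC (Gamma_herm _ (c - a))); congr (_ * _).
exact: (@euler_integral_pfaff n _ _ _ x hx px (Reb _ a1) (Reb _ ca1)).
Qed.

End Pfaff.

(** * The Radon integral, its permutation invariance and its Euler form *)

Section RadonRelation.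
Local Open Scope complex_scope.
Variables (R : realType) (r : nat).
Local Notation C := R[i].

(** Block j of z P_s is z_{s^-1 j}, matching the permuted exponents, so the product over j is merely
    reindexed and the integrands coincide pointwise. *)
Lemma radon_perm (z : 'M[C]_(r + r, \sum_(j < 4) r)) alpha (s : 'S_4) D :
  radon (z *m perm_block R r s) (perm_exponents s alpha) D = radon z alpha D.
Proof.
have zE j : zblock (z *m perm_block R r s) j = zblock z (s^-1%g j).
  rewrite /zblock -{1}(submxrowK z) /perm_block mul_mxrow_mxblock mxrowK.
  rewrite (bigD1 (s^-1%g j))//= permKV eqxx mulmx1 big1 ?addr0// => i ij.
  case: eqVneq => [sij|]; last by rewrite mulmx0.
  by move: ij; rewrite -sij permK eqxx.
rewrite /radon.
have -> // : radon_integrand (z *m perm_block R r s) (perm_exponents s alpha) =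
    radon_integrand z alpha.
apply/funext => t; rewrite /radon_integrand /perm_exponents.
rewrite [in RHS](reindex_inj (@perm_inj _ s^-1%g)).
apply: (congr1 (fun p => p * \det (lsubmx t) ^+ (r + r))).
apply: eq_bigr => j _.
rewrite (zE j).
reflexivity.
Qed.

Lemma cpow1 (s : C) : cpow 1 s = 1.
Proof.
rewrite -(rmorph1 (real_complex R)) cpow_real// /cpowr ln1 mulr0.
by rewrite /cexp /= expR0 cos0 sin0 mulr1 mulr0.
Qed.

(** For t = (1, U) the products t z_j are 1, U, 1 - U and 1 - U x; the exponent alpha_0 disappears
    with the power of 1. *)
Lemma radon_xconfig alpha (x : 'M[C]_r) :
  radon (xconfig x) alpha (unit_box R r) = (- 2 * Complex 0 1) ^+ (r * r.-1)./2 *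
  herm_integral (unit_box R r)
    (euler_integrand (alpha (inord 1)) (alpha (inord 2)) (alpha (inord 3)) x).
Proof.
rewrite /radon.
have -> // : (fun u => radon_integrand (xconfig x) alpha (row_mx 1%:M u)) =
  euler_integrand (alpha (inord 1)) (alpha (inord 2)) (alpha (inord 3)) x.
apply/funext => U; rewrite /radon_integrand row_mxKl det1 expr1n mulr1.
have zE j : zblock (xconfig x) j = nth 0 [:: col_mx 1%:M 0; col_mx 0 1%:M;
    col_mx 1%:M (- 1%:M); col_mx 1%:M (- x)] j by exact: mxrowK.
pose F (j : 'I_4) := cpow (\det (row_mx 1%:M U *m zblock (xconfig x) j)) (alpha j).
have zK (k : nat) : (k < 4)%N -> zblock (xconfig x) (inord k) =
    nth 0 [:: col_mx 1%:M 0; col_mx 0 1%:M; col_mx 1%:M (- 1%:M); col_mx 1%:M (- x)] k.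
  by move=> k4; rewrite zE inordK.
have F0 : F (inord 0) = 1.
  by rewrite /F zK// mul_row_col mulmx0 mulmx1 addr0 det1 cpow1.
have F1 : F (inord 1) = cpow (\det U) (alpha (inord 1)).
  apply: (congr1 (fun A => cpow (\det A) (alpha (inord 1)))).
  by rewrite (zK 1%N isT) mul_row_col mulmx0 mulmx1 add0r.
have F2 : F (inord 2) = cpow (\det (1%:M - U)) (alpha (inord 2)).
  apply: (congr1 (fun A => cpow (\det A) (alpha (inord 2)))).
  by rewrite (zK 2%N isT) mul_row_col mulmxN !mulmx1.
have F3 : F (inord 3) = cpow (\det (1%:M - U *m x)) (alpha (inord 3)).
  apply: (congr1 (fun A => cpow (\det A) (alpha (inord 3)))).
  by rewrite (zK 3%N isT) mul_row_col mulmxN mulmx1.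
rewrite /euler_integrand -F1 -F2 -F3.
have -> : \prod_j cpow (\det (row_mx 1%:M U *m zblock (xconfig x) j)) (alpha j) =
  \prod_j F j by [].
clearbody F.
have E (k : nat) (i : 'I_4) : val i = k -> i = inord k.
  by move=> <-; rewrite inord_val.
rewrite !big_ord_recl big_ord0 mulr1.
rewrite (E 3%N (lift ord0 (lift ord0 (lift ord0 ord0))) erefl).
rewrite (E 2%N (lift ord0 (lift ord0 ord0)) erefl).
by rewrite (E 1%N (lift ord0 ord0) erefl) (E 0%N ord0 erefl) F0 mul1r mulrA.
Qed.

(** The Jacobian power of -2i between du and dU cancels the power of i/2 in the constant, since
    (i/2)(-2i) = 1. *)
Lemma radon_const_xconfig alpha (x : 'M[C]_r) :
  radon_const r alpha * radon (xconfig x) alpha (unit_box R r) =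
  Gamma_herm r (alpha (inord 1) + alpha (inord 2) + (r + r)%:R) /
   (Gamma_herm r (alpha (inord 1) + r%:R) * Gamma_herm r (alpha (inord 2) + r%:R)) *
  herm_integral (unit_box R r)
    (euler_integrand (alpha (inord 1)) (alpha (inord 2)) (alpha (inord 3)) x).
Proof.
rewrite radon_xconfig /radon_const mulrACA -exprMn.
have -> : Complex 0 1 / 2 * (- 2 * Complex 0 1) = 1 :> C.
  have := sqr_i R; rewrite expr2 => ii.
  rewrite mulNr mulrN mulrA divfK ?pnatr_eq0// ii opprK.
  by [].
by rewrite expr1n mul1r.
Qed.

Lemma radon_const_s12 (alpha : 'I_4 -> C) :
  radon_const r (perm_exponents s12 alpha) = radon_const r alpha.
Proof.
rewrite /radon_const /perm_exponents /s12 tpermV tpermL tpermR.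
move: (@Gamma_herm R r) => G.
by rewrite (addrC (alpha (inord 2))) (mulrC (G (alpha (inord 2) + _))).
Qed.

End RadonRelation.

(** * The group Q as a Klein four-group *)

Section KleinFour.
Local Open Scope group_scope.

Lemma s12_sqr : s12 * s12 = 1. Proof. exact: tperm2. Qed.
Lemma s03_sqr : s03 * s03 = 1. Proof. exact: tperm2. Qed.

Lemma s03_s12 : s12 * s03 = s03 * s12.
Proof.
rewrite [RHS]conjgC; congr (_ * _); rewrite tpermJ.
by rewrite !tpermD// -val_eqE /= !inordK.
Qed.

Lemma QE : Q = [set x in [:: 1; s12; s03; s03 * s12]].
Proof. by apply/setP => x; rewrite !inE !orbA. Qed.

(** All sixteen products are brought to a normal form by moving s03 to the left and cancelling
    squares; closure and commutativity come out together. *)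
Lemma Q_mul x y : x \in Q -> y \in Q -> (x * y \in Q) && (x * y == y * x).
Proof.
have A := (s12_sqr, s03_sqr, s03_s12).
have B z : s12 * (s12 * z) = z by rewrite mulgA s12_sqr mul1g.
have D z : s03 * (s03 * z) = z by rewrite mulgA s03_sqr mul1g.
have E z : s12 * (s03 * z) = s03 * (s12 * z) by rewrite !mulgA s03_s12.
rewrite !QE !inE => /or4P[] /eqP -> /or4P[] /eqP ->;
  by rewrite -?mulgA ?(mul1g, mulg1, A, B, D, E) ?(mul1g, mulg1, A, B, D, E) !eqxx ?orbT.
Qed.

Lemma group_set_Q : group_set Q.
Proof.
apply/group_setP; split=> [|x y Qx Qy]; first by rewrite QE !inE eqxx.
by have /andP[] := Q_mul Qx Qy.
Qed.

(** The images of 0 and 1 distinguish the four permutations. *)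
Lemma card_Q : #|Q| = 4.
Proof.
rewrite QE cardsE; apply/card_uniqP.
have v (i : nat) : (i < 4)%N -> val (inord i : 'I_4) = i.
  by move=> ?; rewrite /= inordK.
have p1 : (s12 : {perm 'I_4}) (inord 1) = inord 2 by exact: tpermL.
have p2 : (s03 : {perm 'I_4}) (inord 1) = inord 1.
  by rewrite tpermD// -val_eqE !v.
have p3 : (s12 : {perm 'I_4}) (inord 0) = inord 0.
  by rewrite tpermD// -val_eqE !v.
have p4 : (s03 : {perm 'I_4}) (inord 0) = inord 3 by exact: tpermL.
have p5 : (s12 : {perm 'I_4}) (inord 3) = inord 3.
  by rewrite tpermD// -val_eqE !v.
have ne (s t : 'S_4) k : val (s (inord k)) != val (t (inord k)) -> s != t.
  by apply: contraNneq => ->.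
rewrite /= !inE !negb_or !andbT.
apply/and3P; split; [apply/and3P; split|apply/andP; split|].
- by apply: (ne _ _ 1%N); rewrite perm1 p1 !v.
- by apply: (ne _ _ 0%N); rewrite perm1 p4 !v.
- by apply: (ne _ _ 0%N); rewrite perm1 permM p4 p5 !v.
- by apply: (ne _ _ 1%N); rewrite p1 p2 !v.
- by apply: (ne _ _ 0%N); rewrite p3 permM p4 p5 !v.
- by apply: (ne _ _ 1%N); rewrite p2 permM p2 p1 !v.
Qed.

(** Elementary abelian 2-groups of equal order are isomorphic, so exponent 2, commutativity and the
    order 4 suffice. *)
Lemma isog_Q : Q \isog [set: 'Z_2 * 'Z_2].
Proof.
pose G := Group group_set_Q.
suff : G \isog [set: 'Z_2 * 'Z_2]%G by [].
have aG : 2.-abelem G.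
  rewrite abelemE//; apply/andP; split.
    apply/centsP => x Gx y Gy; rewrite /commute; apply/eqP.
    by have /andP[] := Q_mul Gx Gy.
  apply/exponentP => x; rewrite -[x \in _]/(x \in Q) QE !inE => /or4P[] /eqP ->.
  - by rewrite expg1n.
  - by rewrite expgS expg1 s12_sqr.
  - by rewrite expgS expg1 s03_sqr.
  - by rewrite expgS expg1 -mulgA (mulgA s12) s03_s12 -!mulgA s12_sqr mulg1 s03_sqr.
rewrite (isog_abelem_card [set: 'Z_2 * 'Z_2]%G aG); apply/andP; split.
  rewrite abelemE//; apply/andP; split.
    by apply/centsP => -[x1 x2] _ [y1 y2] _; congr pair; exact: Zp_mulgC.
  apply/exponentP => -[x1 x2] _; apply/eqP.
  by case: x1 x2 => [[|[|]]] // ? [[|[|]]].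
by rewrite cardsT card_prod !card_ord; apply/eqP/esym; exact: card_Q.
Qed.

End KleinFour.

Theorem proposition5p9 (R : realType) (r : nat) (a b c : R[i])
    (x : 'M[R[i]]_r)
    (r_ge1 : (1 <= r)%N)
    (a_cvg : r%:R - 1 < complex.Re a)
    (ca_cvg : r%:R - 1 < complex.Re (c - a))
    (x_herm : x \is hermsymmx)
    (x_lt1 : posdef (1%:M - x)) :
  [/\ [/\ group_set Q,
          Q \isog [set: 'Z_2 * 'Z_2] &
          s12 \in Q],
      forall alpha : 'I_4 -> R[i],
        exponents_admissible r alpha ->
        config_generic (xconfig x) ->
        a = alpha (inord 1) + r%:R ->
        b = - alpha (inord 3) ->
        c = alpha (inord 1) + alpha (inord 2) + (r + r)%:R ->
        [/\ hypergeo a b c x =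
              radon_const r alpha * radon (xconfig x) alpha (unit_box R r),
            radon (xconfig x *m perm_block R r s12) (perm_exponents s12 alpha)
                (unit_box R r)
              = radon (xconfig x) alpha (unit_box R r) &
            radon_const r (perm_exponents s12 alpha) *
              radon (xconfig x *m perm_block R r s12)
                (perm_exponents s12 alpha) (unit_box R r)
              = cpow (\det (1%:M - x)) (- b) *
                hypergeo (c - a) b c (x *m invmx (x - 1%:M))] &
      hypergeo a b c x =
        cpow (\det (1%:M - x)) (- b) *
        hypergeo (c - a) b c (x *m invmx (x - 1%:M))].
Proof.
have pfaff := hypergeo_pfaff b r_ge1 a_cvg ca_cvg x_herm x_lt1.
split; last exact: pfaff.
  by split; [exact: group_set_Q | exact: isog_Q | rewrite QE !inE eqxx orbT].
move=> alpha _ _ aE bE cE.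
have radonE : hypergeo a b c x =
    radon_const r alpha * radon (xconfig x) alpha (unit_box R r).
  (* Hence the Euler exponents a - r and c - a - r are alpha_1 and alpha_2. *)
  have caE : c - a = alpha (inord 2) + r%:R by rewrite aE cE natrD; ring.
  rewrite radon_const_xconfig /hypergeo /euler_integrand caE aE bE cE opprK !addrK.
  reflexivity.
split; [exact: radonE | exact: radon_perm |].
(* The constant and the integral are both invariant under (1,2), so the permuted expression still
   equals the original hypergeometric value, to which the substitution formula applies. *)
by rewrite radon_const_s12 radon_perm -radonE; exact: pfaff.
Qed.
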